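(* Let $a>0$ be fixed, and let $X,X_1,X_2,\ldots$ be i.i.d. $d$-dimensional random vectors, with distribution absolutely continuous with respect to Lebesgue measure, such that $\mathbb{E}\|X\|^4<\infty$, $\mathbb{E}(X)=0$ and $\mathbb{E}(XX^\top)=\mathrm{I}_d$. Then, as $n\to\infty$, $$\frac{U_{n,a}}{n}\longrightarrow\Gamma_a:=\int_{\mathbb{R}^d}z^2(t)\,w_a(t)\,\mathrm{d}t\quad\text{almost surely},$$ where $$z(t)=-\Delta\psi^+(t)+(\|t\|^2-d)\psi^+(t),\quad t\in\mathbb{R}^d .$$
   Context: $\|\cdot\|$ is the Euclidean norm, $\mathrm{I}_d$ the identity matrix of size $d$, $\Delta$ the Laplace operator, and $w_a(t)=\exp(-a\|t\|^2)$. Put $\psi^+(t)=\mathbb{E}[\cos(t^\top X)]+\mathbb{E}[\sin(t^\top X)]$, $t\in\mathbb{R}^d$. For $n\ge d+1$ put $\overline X_n=n^{-1}\sum_{j=1}^nX_j$, $S_n=n^{-1}\sum_{j=1}^n(X_j-\overline X_n)(X_j-\overline X_n)^\top$ (almost surely invertible), and $Y_{n,j}=S_n^{-1/2}(X_j-\overline X_n)$, where $S_n^{-1/2}$ is the unique symmetric positive definite square root of $S_n^{-1}$. Let $\psi_n(t)=n^{-1}\sum_{j=1}^n\exp(\mathrm{i}t^\top Y_{n,j})$ and $$U_{n,a}=n\int_{\mathbb{R}^d}\left|\Delta\psi_n(t)-\left(\|t\|^2-d\right)\psi_n(t)\right|^2w_a(t)\,\mathrm{d}t .$$ *)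

(* Defs.v *)
From HB Require Import structures.
From mathcomp Require Import all_boot all_order all_algebra.
From mathcomp Require Import complex.
From mathcomp Require Import all_classical all_reals all_analysis.

Set Implicit Arguments.
Unset Strict Implicit.
Unset Printing Implicit Defensive.

Import Order.TTheory GRing.Theory Num.Theory.
Import numFieldNormedType.Exports.

Local Open Scope classical_set_scope.
Local Open Scope ring_scope.

(* The product sigma-algebra on 'M[R]_(m, n), i.e. the one generated by the
   entries.  For real matrices it is the Borel sigma-algebra. *)
Section measurable_matrix.
Context (R : realType) (m n : nat).

Definition mx_cylinder : set (set 'M[R]_(m, n)) :=
  [set A | exists i j, exists2 B : set R,
     measurable B & A = (fun M : 'M[R]_(m, n) => M i j) @^-1` B].

HB.instance Definition _ := @isMeasurable.Build (sigma_display mx_cylinder)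
  'M[R]_(m, n) <<s mx_cylinder >>
  (@sigma_algebra0 _ setT mx_cylinder)
  (@sigma_algebraC _ mx_cylinder)
  (@sigma_algebra_bigcup _ setT mx_cylinder).

Lemma measurable_mx_entry (i : 'I_m) (j : 'I_n) :
  measurable_fun [set: 'M[R]_(m, n)] (fun M : 'M[R]_(m, n) => M i j).
Proof.
by move=> _ B mB; rewrite setTI; apply: sub_sigma_algebra; exists i, j, B.
Qed.

Lemma measurable_fun_mxP d (T : measurableType d) (f : T -> 'M[R]_(m, n)) :
  (forall i j, measurable_fun [set: T] (fun x => f x i j)) ->
  measurable_fun [set: T] f.
Proof.
move=> mf; apply: (@measurability _ _ _ _ _ _ mx_cylinder) => //.
move=> _ [_ [i [j [B mB ->]]] <-]; rewrite setTI.
by have := mf i j measurableT B mB; rewrite setTI.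
Qed.

End measurable_matrix.

(* Lebesgue measure on R^d, as the d-fold product of Lebesgue measure on R. *)
Section lebesgue_cons.
Context (R : realType) (d : nat).
Variable mu : {sigma_finite_measure set 'cV[R]_d -> \bar R}.

Definition cons_cV (p : measurableTypeR R * 'cV[R]_d) : 'cV[R]_d.+1 :=
  \col_i oapp (fun j => p.2 j ord0) p.1 (unlift ord0 i).

Lemma cons_cV0 p : cons_cV p ord0 ord0 = p.1.
Proof. by rewrite mxE unlift_none. Qed.

Lemma cons_cVS p i : cons_cV p (lift ord0 i) ord0 = p.2 i ord0.
Proof. by rewrite mxE liftK. Qed.

Lemma measurable_cons_cV : measurable_fun [set: _] cons_cV.
Proof.
apply: measurable_fun_mxP => i j; rewrite (ord1 j).
case: (unliftP ord0 i) => [k ->|->].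
  rewrite (_ : (fun _ => _) =
    (fun v : 'cV[R]_d => v k ord0) \o snd); last first.
    by apply/funext => p /=; rewrite cons_cVS.
  by apply: measurableT_comp => //; exact: measurable_mx_entry.
by rewrite (_ : (fun _ => _) = fst)//; apply/funext => p /=; rewrite cons_cV0.
Qed.

HB.instance Definition _ := isMeasurableFun.Build _ _ _ _ cons_cV
  measurable_cons_cV.

Definition lebesgue_cons : set 'cV[R]_d.+1 -> \bar R :=
  pushforward (@lebesgue_measure R \x mu)%E cons_cV.

Let lebesgue_cons0 : lebesgue_cons set0 = 0%E.
Proof. by rewrite /lebesgue_cons /pushforward preimage_set0 measure0. Qed.

Let lebesgue_cons_ge0 A : (0 <= lebesgue_cons A)%E.
Proof. exact: measure_ge0. Qed.

Let lebesgue_cons_sigma_additive : semi_sigma_additive lebesgue_cons.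
Proof.
exact: (@measure_semi_sigma_additive _ _ _
  (pushforward (@lebesgue_measure R \x mu)%E cons_cV)).
Qed.

HB.instance Definition _ := isMeasure.Build _ _ _ lebesgue_cons
  lebesgue_cons0 lebesgue_cons_ge0 lebesgue_cons_sigma_additive.

Lemma lebesgue_consE (A : set R) (B : set 'cV[R]_d) :
  measurable A -> measurable B ->
  lebesgue_cons [set v | A (v ord0 ord0) /\
                         B (\col_i v (lift ord0 i) ord0)] =
  (@lebesgue_measure R A * mu B)%E.
Proof.
move=> mA mB; rewrite -product_measure1E//; congr (product_measure1 _ _ _).
apply/seteqP; split => -[x v] /=; rewrite !cons_cV0;
  rewrite (_ : \col_i _ = v)//; apply/colP => i; rewrite mxE cons_cVS//.
Qed.

Let lebesgue_cons_sigma_finite : sigma_finite [set: _] lebesgue_cons.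
Proof.
have /sigma_finiteP[F [FT Fnd mF]] := sigma_finiteT (@lebesgue_measure R).
have /sigma_finiteP[G [GT Gnd mG]] := sigma_finiteT mu.
exists (fun k => [set v : 'cV[R]_d.+1 | F k (v ord0 ord0) /\
                          G k (\col_i v (lift ord0 i) ord0)]).
  apply/esym/seteqP; split => // v _ /=.
  have : [set: R] (v ord0 ord0) by [].
  rewrite FT => -[k _ Fk].
  have : [set: 'cV[R]_d] (\col_i v (lift ord0 i) ord0) by [].
  rewrite GT => -[l _ Gl].
  exists (maxn k l) => //; split.
    by have /subsetPset := Fnd _ _ (leq_maxl k l); exact.
  by have /subsetPset := Gnd _ _ (leq_maxr k l); exact.
move=> k; have [mFk Fk] := mF k; have [mGk Gk] := mG k; split.
  apply: measurableI.
    rewrite -[X in measurable X]setTI.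
    exact: (@measurable_mx_entry R d.+1 1 ord0 ord0 measurableT _ mFk).
  have mtl : measurable_fun [set: 'cV[R]_d.+1]
      (fun v => \col_i v (lift ord0 i) ord0 : 'cV[R]_d).
    apply: measurable_fun_mxP => i j.
    under eq_fun do rewrite mxE.
    exact: measurable_mx_entry.
  by rewrite -[X in measurable X]setTI; exact: mtl.
by rewrite lebesgue_consE//; apply: lte_mul_pinfty => //;
  rewrite ge0_fin_numE.
Qed.

HB.instance Definition _ := Measure_isSigmaFinite.Build _ _ _ lebesgue_cons
  lebesgue_cons_sigma_finite.

End lebesgue_cons.

Fixpoint lebesgue_cV (R : realType) (d : nat) :
    {sigma_finite_measure set 'cV[R]_d -> \bar R} :=
  match d return {sigma_finite_measure set 'cV[R]_d -> \bar R} with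
  | 0 => \d_(0 : 'cV[R]_0)
  | d'.+1 => lebesgue_cons (lebesgue_cV R d')
  end.

Lemma lebesgue_cV_box (R : realType) (d : nat) (a b : 'cV[R]_d) :
  (forall i, a i ord0 <= b i ord0) ->
  lebesgue_cV R d [set v | forall i, v i ord0 \in `[a i ord0, b i ord0]] =
  (\prod_i (b i ord0 - a i ord0))%:E.
Proof.
elim: d => [|d IH] in a b *.
  by move=> _; rewrite big_ord0 /= diracE mem_set// => -[].
move=> ab; pose tl (v : 'cV[R]_d.+1) : 'cV[R]_d := \col_i v (lift ord0 i) ord0.
have mB : measurable [set v : 'cV[R]_d |
    forall i, v i ord0 \in `[tl a i ord0, tl b i ord0]].
  rewrite (_ : [set v | _] = \bigcap_(i in [set: 'I_d])
    (fun v : 'cV[R]_d => v i ord0) @^-1` `[tl a i ord0, tl b i ord0]).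
    apply: fin_bigcap_measurable => [|i _]; first exact: finite_finset.
    rewrite -[X in measurable X]setTI.
    exact: (@measurable_mx_entry R d 1 i ord0).
  by apply/seteqP; split => v /= h i; [move=> _; exact: h | exact: h].
have IHt := IH (tl a) (tl b); rewrite /= in IHt.
transitivity (@lebesgue_measure R `[a ord0 ord0, b ord0 ord0] *
  lebesgue_cV R d [set v | forall i, v i ord0 \in `[tl a i ord0, tl b i ord0]])%E.
  rewrite -lebesgue_consE//; congr (lebesgue_cons _ _).
  apply/seteqP; split => v /=.
    move=> h; split; first exact: h.
    by move=> i; rewrite !mxE; exact: h.
  move=> [h0 h] i; case: (unliftP ord0 i) => [k ->|->] //.
  by have := h k; rewrite !mxE.
rewrite IHt; last by move=> i; rewrite !mxE.
rewrite lebesgue_measure_itv/= lte_fin big_ord_recl EFinM.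
congr (_ * _%:E)%E; last by apply: eq_bigr => i _; rewrite !mxE.
by have := ab ord0; rewrite le_eqVlt => /predU1P[->|->]; rewrite ?ltxx ?subrr.
Qed.

Section iid.
Context d d' (T : measurableType d) (T' : measurableType d') (R : realType).
Variable P : probability T R.

Definition mutually_independent (X : nat -> {RV P >-> T'}) : Prop :=
  forall (J : seq nat) (B : nat -> set T'), uniq J ->
    (forall j, measurable (B j)) ->
    P (\bigcap_(j in [set` J]) X j @^-1` B j) =
    (\prod_(j <- J) P (X j @^-1` B j))%E.

(* Laws are compared on measurable sets only: a measure of the library is a
   function on all sets, unconstrained on the nonmeasurable ones. *)
Definition identically_distributed (X : nat -> {RV P >-> T'}) : Prop :=
  forall (j k : nat) (B : set T'), measurable B ->
    distribution P (X j) B = distribution P (X k) B.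

End iid.

Section euclidean.
Context (R : realType) (d : nat).
Implicit Types (t x : 'cV[R]_d).

Definition dotv t x : R := (t^T *m x) ord0 ord0.

(* The library norm on matrices is the sup norm. *)
Definition enorm t : R := Num.sqrt (dotv t t).

Definition gauss_weight (a : R) t : R := expR (- a * enorm t ^+ 2).

Definition laplacian (f : 'cV[R]_d -> R) t : R :=
  \sum_(i < d) 'D_(delta_mx i ord0) ('D_(delta_mx i ord0) f) t.

(* R[i] is not a normed module over R in the library, so the Laplacian of a
   complex-valued function is taken on its real and imaginary parts. *)
Definition claplacian (f : 'cV[R]_d -> R[i]) t : R[i] :=
  Complex (laplacian (fun s => complex.Re (f s)) t) (laplacian (fun s => complex.Im (f s)) t).

Definition posdefmx (B : 'M[R]_d) : Prop :=
  B^T = B /\ forall x, x != 0 -> 0 < dotv x (B *m x).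

(* The symmetric positive definite square root of A; it exists and is unique
   when A is symmetric positive definite, and is arbitrary otherwise. *)
Definition sqrtmx (A : 'M[R]_d) : 'M[R]_d :=
  get [set B : 'M[R]_d | posdefmx B /\ B *m B = A].

End euclidean.

(* exp(i u) *)
Definition cis (R : realType) (u : R) : R[i] := Complex (cos u) (sin u).

(* The statistic, as a function of the observed values x 1, ..., x n; the value
   x 0 is not used. *)
Section statistic.
Context (R : realType) (d : nat).
Implicit Types (x : nat -> 'cV[R]_d) (n : nat).

Definition sample_mean n x : 'cV[R]_d :=
  n%:R^-1 *: \sum_(1 <= j < n.+1) x j.

Definition sample_cov n x : 'M[R]_d :=
  n%:R^-1 *: \sum_(1 <= j < n.+1)
    (x j - sample_mean n x) *m (x j - sample_mean n x)^T.

Definition scaled_residual n x (j : nat) : 'cV[R]_d :=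
  sqrtmx (invmx (sample_cov n x)) *m (x j - sample_mean n x).

Definition empirical_cf n x (t : 'cV[R]_d) : R[i] :=
  n%:R^-1 * \sum_(1 <= j < n.+1) cis (dotv t (scaled_residual n x j)).

(* The integrand is nonnegative; the integral is taken in the extended reals. *)
Definition test_stat (a : R) n x : \bar R :=
  (n%:R%:E * \int[lebesgue_cV R d]_t
    ((ComplexField.Normc.normc
        (claplacian (empirical_cf n x) t
         - (enorm t ^+ 2 - d%:R)%:C%C * empirical_cf n x t) ^+ 2
      * gauss_weight a t)%:E))%E.

End statistic.

Section limit.
Context (R : realType) (d : nat) disp (Omega : measurableType disp).
Context (P : probability Omega R) (X : {RV P >-> 'cV[R]_d}).

Definition psi_plus (t : 'cV[R]_d) : R :=
  fine 'E_P[fun w => cos (dotv t (X w))] +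
  fine 'E_P[fun w => sin (dotv t (X w))].

Definition zfun (t : 'cV[R]_d) : R :=
  - laplacian psi_plus t + (enorm t ^+ 2 - d%:R) * psi_plus t.

Definition Gamma (a : R) : \bar R :=
  (\int[lebesgue_cV R d]_t ((zfun t ^+ 2 * gauss_weight a t)%:E))%E.

End limit.

(* Main.v *)
Require Import Defs.
From HB Require Import structures.
From mathcomp Require Import all_boot all_order all_algebra.
From mathcomp Require Import complex.
From mathcomp Require Import all_classical all_reals all_analysis.
From mathcomp Require Import measurable_realfun.
From mathcomp Require Import ring lra zify.

Set Implicit Arguments.
Unset Strict Implicit.
Unset Printing Implicit Defensive.

Import Order.TTheory GRing.Theory Num.Theory.
Import numFieldNormedType.Exports.

Local Open Scope classical_set_scope.
Local Open Scope ring_scope.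

(** Write Y_j for the scaled residuals.  Differentiating the empirical
    characteristic function term by term turns the integrand into
    | n^-1 sum_j (|Y_j|^2 + |t|^2 - d) exp(i t.Y_j) |^2, that is, into the sum
    of the squares of the averages over Y_1, ..., Y_n of the two functions
    [wave cos t] and [wave sin t] ([integrandE]).  Differentiating under the
    expectation gives z(t) = C(t) + S(t), where C and S are the means of the
    same two functions at X ([zfunE]).  As C is even and S is odd, the cross
    term 2 C S integrates to zero, and the limit is the integral of C^2 + S^2
    against the weight ([GammaE]).  So it suffices that the averages of the
    waves converge to their means for every t, with a domination in t.

    - The functions of the data that are averaged grow quadratically, so a
      fourth moment makes them square integrable, and they obey a strong law
      with an elementary proof ([strong_law_iid]): the variances of the averages
      over the first k^2 observations are summable in k, and monotonicity in n
      fills the gaps between squares for nonnegative functions.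

    - The strong law for the entries and for their products gives S_n -> 1.
      The root B of S_n^-1 satisfies (B + 1)(B - 1) = S_n^-1 - 1, which forces
      B -> 1 as B is positive; hence |Y_j - X_j| <= e (1 + |X_j|) for all j
      at once when n is large ([scaled_residual_close]).  That the root exists
      is the spectral theorem ([posdef_sqrt]).

    - Almost sure convergence can only be asked for countably many functions.
      The change of [wave tau t x] when t and x move a little is at most an
      arbitrarily small multiple of 1 + |x|^2 plus a multiple of the envelope
      (1 + |x|^2) min(1, (1 + |x|)/(k + 1)) ([ler_dist_wave]), whose mean tends
      to 0 as k grows.  So rational frequencies suffice, and the residuals may
      replace the observations ([cvg_avg_wave]).

    - For large n the averages are bounded by K + |t|^2 with a constant K, and
      dominated convergence applies, the weight being Gaussian
      ([cvg_test_stat]). *)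

(** * Euclidean geometry and the positive definite square root *)

Section euclidean_space.
Context (R : realType) (d : nat).
Implicit Types (x y z : 'cV[R]_d) (M : 'M[R]_d).

Lemma dotvE x y : dotv x y = \sum_i x i ord0 * y i ord0.
Proof. by rewrite /dotv mxE; apply: eq_bigr => i _; rewrite mxE. Qed.

Lemma dotvC x y : dotv x y = dotv y x.
Proof. by rewrite !dotvE; apply: eq_bigr => i _; rewrite mulrC. Qed.

Lemma dotvDr x y z : dotv x (y + z) = dotv x y + dotv x z.
Proof. by rewrite /dotv mulmxDr mxE. Qed.

Lemma dotvZr x a y : dotv x (a *: y) = a * dotv x y.
Proof. by rewrite /dotv -scalemxAr mxE. Qed.

Lemma dotvNr x y : dotv x (- y) = - dotv x y.
Proof. by rewrite /dotv mulmxN mxE. Qed.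

Lemma dotvBr x y z : dotv x (y - z) = dotv x y - dotv x z.
Proof. by rewrite dotvDr dotvNr. Qed.

Lemma dotvDl x y z : dotv (x + y) z = dotv x z + dotv y z.
Proof. by rewrite !(dotvC _ z) dotvDr. Qed.

Lemma dotvZl x a y : dotv (a *: x) y = a * dotv x y.
Proof. by rewrite !(dotvC _ y) dotvZr. Qed.

Lemma dotvNl x y : dotv (- x) y = - dotv x y.
Proof. by rewrite !(dotvC _ y) dotvNr. Qed.

Lemma dotvBl x y z : dotv (x - y) z = dotv x z - dotv y z.
Proof. by rewrite dotvDl dotvNl. Qed.

Lemma dotv0r x : dotv x 0 = 0.
Proof. by rewrite /dotv mulmx0 mxE. Qed.

Lemma dotv_mulmx M x y : dotv x (M *m y) = dotv (M^T *m x) y.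
Proof. by rewrite /dotv trmx_mul trmxK mulmxA. Qed.

Lemma dotvv_ge0 x : 0 <= dotv x x.
Proof. by rewrite dotvE sumr_ge0// => i _; rewrite -expr2 sqr_ge0. Qed.

Lemma dotvv_eq0 x : (dotv x x == 0) = (x == 0).
Proof.
apply/eqP/eqP => [|->]; last exact: dotv0r.
rewrite dotvE => /eqP; rewrite psumr_eq0; last first.
  by move=> i _; rewrite -expr2 sqr_ge0.
move=> /allP x0; apply/colP => i; rewrite mxE.
by have := x0 i (mem_index_enum i); rewrite /= mulf_eq0 orbb => /eqP.
Qed.

Lemma enorm_ge0 x : 0 <= enorm x.
Proof. exact: sqrtr_ge0. Qed.

Lemma sqr_enorm x : enorm x ^+ 2 = dotv x x.
Proof. by rewrite sqr_sqrtr// dotvv_ge0. Qed.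

Lemma enorm0 : enorm (0 : 'cV[R]_d) = 0.
Proof. by rewrite /enorm dotv0r sqrtr0. Qed.

Lemma enormN x : enorm (- x) = enorm x.
Proof. by rewrite /enorm dotvNl dotvNr opprK. Qed.

Lemma ler_dotv x y : `|dotv x y| <= enorm x * enorm y.
Proof.
rewrite -(ler_pXn2r (n := 2))// ?nnegrE ?mulr_ge0 ?enorm_ge0//.
rewrite real_normK ?num_real// exprMn !sqr_enorm.
have [->|y0] := eqVneq y 0; first by rewrite !dotv0r expr0n mulr0.
have yy : 0 < dotv y y by rewrite lt_neqAle eq_sym dotvv_eq0 y0 dotvv_ge0.
have := dotvv_ge0 (dotv y y *: x - dotv x y *: y).
rewrite dotvBl !dotvBr !dotvZl !dotvZr (dotvC y x) => h.
rewrite -subr_ge0 -(pmulr_rge0 _ yy); apply: le_trans h _.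
by rewrite le_eqVlt; apply/orP; left; apply/eqP; ring.
Qed.

Lemma ler_enormD x y : enorm (x + y) <= enorm x + enorm y.
Proof.
rewrite -(ler_pXn2r (n := 2))// ?nnegrE ?addr_ge0 ?enorm_ge0//.
rewrite sqrrD !sqr_enorm dotvDl !dotvDr (dotvC y x).
have := le_trans (ler_norm _) (ler_dotv x y); lra.
Qed.

Lemma ler_enormB x y : enorm (x - y) <= enorm x + enorm y.
Proof. by rewrite -(enormN y) ler_enormD. Qed.

Lemma ler_entry_enorm x i : `|x i ord0| <= enorm x.
Proof.
rewrite -(ler_pXn2r (n := 2))// ?nnegrE ?enorm_ge0//.
rewrite real_normK ?num_real// sqr_enorm dotvE (bigD1 i)//= expr2 lerDl.
by rewrite sumr_ge0// => j _; rewrite -expr2 sqr_ge0.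
Qed.

Lemma ler_enorm_sum x : enorm x <= \sum_i `|x i ord0|.
Proof.
have s0 : 0 <= \sum_i `|x i ord0| by rewrite sumr_ge0.
rewrite -(ler_pXn2r (n := 2))// ?nnegrE ?enorm_ge0// sqr_enorm dotvE.
rewrite expr2 mulr_suml; apply: ler_sum => i _.
rewrite (le_trans (ler_norm _))// normrM ler_wpM2l//.
by rewrite (bigD1 i)//= lerDl sumr_ge0.
Qed.

(** Any matrix norm would do to control S - 1; this one dominates the operator
    norm by inspection of the entries. *)
Definition mxsum1 M : R := \sum_i \sum_j `|M i j|.

Lemma mxsum1_ge0 M : 0 <= mxsum1 M.
Proof. by rewrite sumr_ge0// => i _; rewrite sumr_ge0. Qed.

Lemma ler_enorm_mulmx M x : enorm (M *m x) <= mxsum1 M * enorm x.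
Proof.
rewrite (le_trans (ler_enorm_sum _))// mulr_suml; apply: ler_sum => i _.
rewrite mxE (le_trans (ler_norm_sum _ _ _))// mulr_suml; apply: ler_sum => j _.
by rewrite normrM ler_wpM2l// ler_entry_enorm.
Qed.

End euclidean_space.

Section square_root.
Context (R : realType).

Lemma poly_interpolation (f : R -> R) (s : seq R) :
  exists p : {poly R}, forall x, x \in s -> p.[x] = f x.
Proof.
elim: s => [|x s [p hp]]; first by exists 0.
have [xs|xs] := boolP (x \in s).
  by exists p => y; rewrite inE => /predU1P[->|]; exact: hp.
pose q := \prod_(y <- s) ('X - y%:P).
exists (p + ((f x - p.[x]) / q.[x]) *: q) => y.
rewrite inE hornerD hornerZ => /predU1P[->|ys].
  rewrite divfK ?subrKC//; apply: contra xs => qx.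
  by rewrite -root_prod_XsubC.
have /eqP -> : root q y by rewrite root_prod_XsubC.
by rewrite mulr0 addr0 hp.
Qed.

Lemma trmx_horner_mx n (A : 'M[R]_n.+1) (p : {poly R}) :
  (horner_mx A p)^T = horner_mx A^T p.
Proof.
elim/poly_ind: p => [|p c ih]; first by rewrite !rmorph0 trmx0.
rewrite !rmorphD !rmorphM /= !horner_mx_X !horner_mx_C linearD/= tr_scalar_mx.
rewrite trmx_mul ih; congr (_ + _).
by have := comm_horner_mx2 A^T 'X p; rewrite /GRing.comm horner_mx_X.
Qed.

(** A real symmetric matrix is unitarily diagonalizable over the complex
    numbers with real eigenvalues, so a real polynomial through the points
    (l, l^(1/4)), l an eigenvalue, gives a real symmetric fourth root C;
    then C^2 is a square root, and it is positive because x.C^2x = |Cx|^2. *)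
Lemma posdef_sqrt d (A : 'M[R]_d) : posdefmx A ->
  exists B : 'M[R]_d, posdefmx B /\ B *m B = A.
Proof.
case: d A => [|d] A [Asym Apos].
  exists 0; split; last by apply/matrixP => -[].
  by split=> [|x]; [rewrite trmx0|rewrite (flatmx0 x) eqxx].
pose toC : {rmorphism R -> R[i]} := @real_complex R.
pose AC := map_mx toC A.
have ACherm : AC \is hermsymmx.
  apply: realsym_hermsym.
    apply/is_hermitianmxP; rewrite expr0 scale1r.
    by apply/matrixP => i j; rewrite !mxE -{1}Asym mxE.
  by apply/mxOverP => i j; rewrite mxE complex_real.
pose U := spectralmx AC; pose D := spectral_diag AC.
have Uu : U \in unitmx by exact: spectral_unit.
have ACE : AC = invmx U *m diag_mx D *m U.
  exact/orthomx_spectralP/hermitian_normalmx.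
have Dreal : D \is a realmx by exact: hermitian_spectral_diag_real.
pose ev i := complex.Re (D ord0 i).
have evE i : D ord0 i = toC (ev i).
  by rewrite -[LHS](RRe_real (mxOverP Dreal ord0 i)).
have ev_gt0 i : 0 < ev i.
  have : \det (A - (ev i)%:M) == 0.
    have detE : toC (\det (A - (ev i)%:M)) = \det (AC - (D ord0 i)%:M).
      by rewrite -det_map_mx map_mxB map_scalar_mx evE.
    rewrite -(inj_eq (fmorph_inj toC)) rmorph0 detE ACE.
    rewrite [X in _ - X](_ : (D ord0 i)%:M = invmx U *m (D ord0 i)%:M *m U); last first.
      by rewrite scalar_mxC mulmxKV.
    rewrite -mulmxBl -mulmxBr !det_mulmx (_ : diag_mx D - _ = diag_mx (D - const_mx (D ord0 i))).
      by rewrite det_diag (bigD1 i)//= !mxE subrr mul0r mulr0 mul0r.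
    by apply/matrixP => k l; rewrite !mxE -mulrnBl.
  move=> /det0P[v v0 vA].
  have x0 : v^T != 0 by rewrite -trmx0 (inj_eq trmx_inj).
  have Ax : A *m v^T = ev i *: v^T.
    rewrite -{1}Asym -trmx_mul; apply/eqP; rewrite -subr_eq0.
    by rewrite -linearZ/= -linearB/= -mul_mx_scalar -mulmxBr vA trmx0.
  have := Apos _ x0; rewrite Ax dotvZr pmulr_lgt0//.
  by rewrite lt_neqAle eq_sym dotvv_eq0 x0 dotvv_ge0.
have [p hp] := poly_interpolation (fun x => Num.sqrt (Num.sqrt x)) [seq ev i | i <- enum 'I_d.+1].
have hE q : map_mx toC (horner_mx A q) =
    invmx U *m diag_mx (\row_i toC q.[ev i]) *m U.
  rewrite map_horner_mx.
  have -> : \row_i toC q.[ev i] = map_mx (horner (map_poly toC q)) D.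
    by apply/rowP => i; rewrite !mxE evE horner_map.
  rewrite -horner_mx_diag.
  transitivity (horner_mx (invmx U *m diag_mx D *m U) (map_poly toC q)).
    by rewrite -ACE.
  by apply: horner_mx_uconjC.
pose C := horner_mx A p.
have CT : C^T = C by rewrite trmx_horner_mx Asym.
have C4 : C *m C *m (C *m C) = A.
  have <- : horner_mx A (p ^+ 4) = C *m C *m (C *m C).
    by rewrite rmorphXn /= !exprS expr0 mulr1 !mulmxE !mulrA.
  apply: (map_mx_inj (f := toC)); rewrite hE.
  have -> : \row_i toC (p ^+ 4).[ev i] = D.
    apply/rowP => i; rewrite mxE evE horner_exp hp ?map_f ?mem_enum//.
    rewrite (_ : 4 = 2 * 2)%N// exprM !sqr_sqrtr ?sqrtr_ge0//.
    exact: ltW.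
  exact: esym ACE.
exists (C *m C); split => //; split=> [|x x0]; first by rewrite trmx_mul CT.
rewrite -mulmxA dotv_mulmx CT lt_neqAle dotvv_ge0 andbT eq_sym dotvv_eq0.
apply: contra x0 => /eqP Cx0.
have : dotv x (A *m x) = 0 by rewrite -C4 -!mulmxA Cx0 !mulmx0 dotv0r.
by apply: contra_eqT => /Apos; rewrite lt_neqAle eq_sym => /andP[].
Qed.

(** The defining square root is only chosen among candidates, so this is what
    gives it its two properties. *)
Lemma sqrtmxP d (A : 'M[R]_d) : posdefmx A ->
  posdefmx (sqrtmx A) /\ sqrtmx A *m sqrtmx A = A.
Proof.
move=> /posdef_sqrt ex_sqrt; rewrite /sqrtmx.
by case: xgetP => [B _ []//|no]; case: ex_sqrt => B hB; case: (no B).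
Qed.

End square_root.

(** * A strong law of large numbers under second moments *)

Section squares.
Context {R : realType}.
Implicit Types S : nat -> R.

Lemma sqrtn_exists : exists r : nat -> nat,
  forall n, (r n ^ 2 <= n < (r n).+1 ^ 2)%N.
Proof.
suff h n : exists r, (r ^ 2 <= n < r.+1 ^ 2)%N.
  by have [r rP] := choice h; exists r.
elim: n => [|n [r /andP[rn nr]]]; first by exists 0%N.
have [h|h] := leqP (r.+1 ^ 2)%N n.+1.
  by exists r.+1; rewrite h/= !expnS !expn0 in nr *; nia.
by exists r; rewrite h andbT (leq_trans rn).
Qed.

(** Between consecutive squares a nondecreasing sum changes by a factor which
    tends to 1, so convergence of the averages along the squares suffices. *)
Lemma cvg_avg_squares S (l : R) : (forall n, 0 <= S n) ->
  {homo S : m n / (m <= n)%N >-> m <= n} ->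
  (fun k => S (k.+1 ^ 2)%N / (k.+1 ^ 2)%N%:R) @ \oo --> l ->
  (fun n => S n / n%:R) @ \oo --> l.
Proof.
move=> S0 Smono Sl; have [r rP] := sqrtn_exists.
have rlim : (fun n => (r n).-1) @ \oo --> \oo.
  apply/cvgnyPge => A; near=> n.
  have /andP[_] := rP n.
  have : (A.+2 ^ 2 <= n)%N by near: n; exact: nbhs_infty_ge.
  rewrite !expnS !expn0; move: (r n) => q h1 h2; nia.
have q1 : (fun k => (k.+2%:R / k.+1%:R : R)) @ \oo --> (1 : R).
  have -> : (fun k => (k.+2%:R / k.+1%:R : R)) = (fun k => 1 + k.+1%:R^-1).
    by apply/funext => k; rewrite -[k.+2]addn1 natrD mulrDl mul1r divff ?pnatr_eq0.
  rewrite -[X in _ --> X]addr0; apply: cvgD; first exact: cvg_cst.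
  exact: cvg_harmonic.
have q1' : (fun k => (k.+1%:R / k.+2%:R : R)) @ \oo --> (1 : R).
  have -> : (fun k => (k.+1%:R / k.+2%:R : R)) = (fun k => (k.+2%:R / k.+1%:R)^-1).
    by apply/funext => k; rewrite invf_div.
  by rewrite -[X in _ --> X]invr1; apply: cvgV.
pose a k := S (k.+1 ^ 2)%N / (k.+1 ^ 2)%N%:R.
have lo : (fun k => a k * (k.+1%:R / k.+2%:R) ^+ 2) @ \oo --> l.
  rewrite -[X in _ --> X]mulr1 -[X in _ * X](expr1n _ 2).
  by apply: cvgM => //; rewrite !expr2; apply: cvgM.
have hi : (fun k => a k.+1 * (k.+2%:R / k.+1%:R) ^+ 2) @ \oo --> l.
  rewrite -[X in _ --> X]mulr1 -[X in _ * X](expr1n _ 2).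
  apply: cvgM; last by rewrite !expr2; apply: cvgM.
  by rewrite -/a -cvg_shiftS in Sl.
apply: (squeeze_cvgr _ (cvg_comp _ _ rlim lo) (cvg_comp _ _ rlim hi)).
near=> n; rewrite /= /a.
have /andP[] := rP n.
have : (0 < r n)%N.
  have : (1 <= n)%N by near: n; exact: nbhs_infty_ge.
  have /andP[_] := rP n; case: (r n) => //; rewrite expnS muln1 => /=; lia.
case: (r n) => // q _ /= qn nq.
have n0 : 0 < n%:R :> R.
  rewrite ltr0n; apply: leq_trans qn; by rewrite expn_gt0.
have k1 k : 0 < (k.+1 ^ 2)%N%:R :> R by rewrite ltr0n expn_gt0.
apply/andP; split.
  rewrite expr_div_n -!natrX mulrA divfK; last by rewrite gt_eqF.
  rewrite ler_pM ?invr_ge0 ?ler0n ?S0 ?Smono// lef_pV2 ?posrE//.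
  by rewrite ler_nat ltnW.
rewrite expr_div_n -!natrX mulrA divfK; last by rewrite gt_eqF.
rewrite ler_pM ?invr_ge0 ?ler0n ?S0 ?Smono//; first exact: ltnW.
by rewrite lef_pV2 ?posrE// ler_nat.
Unshelve. all: end_near. Qed.

End squares.

Section strong_law.
Context d (T : measurableType d) (R : realType) (P : probability T R).
Local Open Scope ereal_scope.

Section nonnegative.
Variables (Z : nat -> T -> R) (m s : R).
Hypothesis mZ : forall j, measurable_fun setT (Z j).
Hypothesis Z0 : forall j w, (0 <= Z j w)%R.
Hypothesis EZ : forall j, \int[P]_w (Z j w)%:E = m%:E.
Hypothesis EZZ : forall j, \int[P]_w (Z j w ^+ 2)%:E = s%:E.
Hypothesis EZjk : forall j k, j != k ->
  \int[P]_w (Z j w * Z k w)%:E = (m * m)%:E.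

Let S n w : R := (\sum_(1 <= j < n.+1) Z j w)%R.

Let mS n : measurable_fun setT (S n).
Proof. exact: measurable_sum. Qed.

Let S0 n w : (0 <= S n w)%R.
Proof. exact: sumr_ge0. Qed.

Let ES n : \int[P]_w (S n w)%:E = (n%:R * m)%:E.
Proof.
under eq_integral do rewrite -sumEFin.
rewrite ge0_integral_sum//=; last first.
- by move=> j w _; rewrite lee_fin.
- by move=> j; exact/measurable_EFinP.
under eq_bigr do rewrite EZ.
by rewrite sumEFin sumr_const_nat subn1/= mulr_natl.
Qed.

Let ESZ n : \int[P]_w (S n w * Z n.+1 w)%:E = (n%:R * (m * m))%:E.
Proof.
under eq_integral do rewrite mulr_suml -sumEFin.
rewrite ge0_integral_sum//=; last first.
- by move=> j w _; rewrite lee_fin mulr_ge0.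
- by move=> j; apply/measurable_EFinP; exact: measurable_funM.
rewrite big_nat; under eq_bigr.
  move=> j /andP[_ jn]; rewrite EZjk; last by rewrite neq_ltn jn.
  over.
by rewrite -big_nat sumEFin sumr_const_nat subn1/= mulr_natl.
Qed.

Let ESS n : \int[P]_w (S n w ^+ 2)%:E =
  (n%:R * s + (n%:R ^+ 2 - n%:R) * (m * m))%:E.
Proof.
elim: n => [|n ih].
  under eq_integral do rewrite /S big_geq// expr0n.
  by rewrite integral_cst//= mul0e; congr (_%:E); ring.
have SE w : (S n.+1 w ^+ 2)%:E =
    (S n w ^+ 2)%:E + (2%:E * (S n w * Z n.+1 w)%:E + (Z n.+1 w ^+ 2)%:E).
  by rewrite /S big_nat_recr//= -EFinM -!EFinD; congr (_%:E); ring.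
under eq_integral do rewrite SE.
rewrite ge0_integralD//=; last 4 first.
- by move=> w _; rewrite lee_fin sqr_ge0.
- by apply/measurable_EFinP; exact: measurable_funX.
- by move=> w _; rewrite -EFinM -EFinD lee_fin addr_ge0 ?sqr_ge0 ?mulr_ge0.
- apply: emeasurable_funD; last by apply/measurable_EFinP; exact: measurable_funX.
  by apply: measurable_funeM; apply/measurable_EFinP; exact: measurable_funM.
rewrite ge0_integralD//=; last 4 first.
- by move=> w _; rewrite -EFinM lee_fin ?mulr_ge0.
- by apply: measurable_funeM; apply/measurable_EFinP; exact: measurable_funM.
- by move=> w _; rewrite lee_fin sqr_ge0.
- by apply/measurable_EFinP; exact: measurable_funX.
rewrite ge0_integralZl_EFin//=; last 2 first.
- by move=> w _; rewrite lee_fin mulr_ge0.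
- by apply/measurable_EFinP; exact: measurable_funM.
rewrite ih ESZ EZZ -EFinM -!EFinD -natr1; congr (_%:E); ring.
Qed.

Let m0 : (0 <= m)%R.
Proof. by rewrite -lee_fin -(EZ 0%N) integral_ge0// => w _; rewrite lee_fin. Qed.

(** All integrands are nonnegative once the cross term is moved to the other
    side, so no integrability has to be checked. *)
Let var_S n : \int[P]_w ((S n w - n%:R * m) ^+ 2)%:E = (n%:R * (s - m * m))%:E.
Proof.
have mV : measurable_fun setT (fun w => ((S n w - n%:R * m) ^+ 2)%:E).
  by apply/measurable_EFinP; apply: measurable_funX; exact: measurable_funB.
have nm0 : (0 <= n%:R * m)%R by rewrite mulr_ge0.
have : \int[P]_w (((S n w - n%:R * m) ^+ 2)%:E + (2 * (n%:R * m))%:E * (S n w)%:E) =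
    \int[P]_w ((S n w ^+ 2)%:E + ((n%:R * m) ^+ 2)%:E).
  by apply: eq_integral => w _; rewrite -EFinM -!EFinD; congr (_%:E); ring.
rewrite ge0_integralD//=; last 3 first.
- by move=> w _; rewrite lee_fin sqr_ge0.
- by move=> w _; rewrite -EFinM lee_fin !mulr_ge0.
- by apply: measurable_funeM; exact/measurable_EFinP.
rewrite ge0_integralZl_EFin//=; last 3 first.
- by move=> w _; rewrite lee_fin.
- exact/measurable_EFinP.
- by rewrite mulr_ge0.
rewrite ES ge0_integralD//=; last 3 first.
- by move=> w _; rewrite lee_fin sqr_ge0.
- by apply/measurable_EFinP; exact: measurable_funX.
- by move=> w _; rewrite lee_fin sqr_ge0.
rewrite ESS integral_cst//= probability_setT mule1 -EFinM -EFinD => h.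
have Vfin : \int[P]_w ((S n w - n%:R * m) ^+ 2)%:E \is a fin_num.
  by move: h; case: (\int[P]_w _).
move: h; rewrite -(fineK Vfin) -EFinD => -[h]; congr (_%:E).
by move: h; move: (fine _) => v h; lra.
Qed.

Let D k w : R := ((S (k.+1 ^ 2)%N w / (k.+1 ^ 2)%N%:R - m) ^+ 2)%R.

Let mD k : measurable_fun setT (EFin \o D k).
Proof.
apply/measurable_EFinP; apply: measurable_funX; apply: measurable_funB => //.
exact: measurable_funM.
Qed.

Let ED k : \int[P]_w (D k w)%:E = ((s - m * m) / (k.+1%:R ^+ 2))%:E.
Proof.
have k0 : (k.+1%:R != 0 :> R)%R by rewrite pnatr_eq0.
have DE w : (D k w)%:E = (((k.+1 ^ 2)%N%:R ^- 2)%:E *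
    ((S (k.+1 ^ 2)%N w - (k.+1 ^ 2)%N%:R * m) ^+ 2)%:E).
  by rewrite -EFinM /D natrX; congr (_%:E);
    move: (S _ w) (k.+1%:R : R)%R k0 => y x x0; field.
under eq_integral do rewrite DE.
rewrite ge0_integralZl_EFin//=; last 2 first.
- by move=> w _; rewrite lee_fin sqr_ge0.
- by apply/measurable_EFinP; apply: measurable_funX; exact: measurable_funB.
rewrite var_S -EFinM natrX; congr (_%:E).
by move: (k.+1%:R : R)%R k0 => x x0; field.
Qed.

Let var_ge0 : (0 <= s - m * m)%R.
Proof.
have := ED 0%N; rewrite expr1n divr1 => h; rewrite -lee_fin -h.
by apply: integral_ge0 => w _; rewrite lee_fin sqr_ge0.
Qed.

Let sum_ED : \sum_(0 <= k <oo) \int[P]_w (D k w)%:E < +oo.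
Proof.
have D0 k : 0 <= \int[P]_w (D k w)%:E.
  by apply: integral_ge0 => w _; rewrite lee_fin sqr_ge0.
(* 1/(k+1)^2 <= 2/(k+1) - 2/(k+2), which telescopes *)
have bnd n : (\sum_(0 <= k < n) (k.+1%:R ^- 2 : R) <= 2 - 2 / n.+1%:R)%R.
  elim: n => [|n ih]; first by rewrite big_geq// invr1; lra.
  rewrite big_nat_recr//=; apply: le_trans (lerD ih (lexx _)) _.
  have n1 : (0 < n.+1%:R :> R)%R by rewrite ltr0n.
  have -> : (n.+2%:R = n.+1%:R + 1 :> R)%R by rewrite -natr1.
  move: n1; have : (1 <= n.+1%:R :> R)%R by rewrite ler1n.
  move: (n.+1%:R : R)%R => x x1 x0.
  rewrite -subr_ge0.
  have -> : (2 - 2 / (x + 1) - (2 - 2 / x + x ^- 2) = (x - 1) / (x ^+ 2 * (x + 1)))%R.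
    by field; apply/andP; split; rewrite gt_eqF//; lra.
  by rewrite divr_ge0 ?mulr_ge0 ?sqr_ge0//; lra.
apply: (@le_lt_trans _ _ ((s - m * m) * 2)%:E); last exact: ltry.
apply: lime_le; first by apply: is_cvg_nneseries => n _ _; exact: D0.
apply: nearW => n; under eq_bigr do rewrite ED.
rewrite sumEFin lee_fin -mulr_sumr ler_wpM2l//.
by rewrite (le_trans (bnd n))// gerBl divr_ge0.
Qed.

(** With D k the squared error at k^2 observations, the mean of the sum of all
    D k is finite, so the sum is almost surely finite and its terms tend
    to 0. *)
Lemma strong_law_ge0 :
  {ae P, forall w, (fun n => S n w / n%:R)%R @ \oo --> m}.
Proof.
pose f w := \sum_(0 <= k <oo) (D k w)%:E.
have D0 k w : 0 <= (D k w)%:E by rewrite lee_fin sqr_ge0.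
have mf : measurable_fun setT f.
  by apply: ge0_emeasurable_sum => [k w _ _|k _]; [exact: D0|exact: mD].
have f0 w : 0 <= f w by apply: nneseries_ge0 => n _ _; exact: D0.
have intf : P.-integrable setT f.
  apply/integrableP; split => //.
  under eq_integral do rewrite gee0_abs//.
  by rewrite integral_nneseries.
have := integrable_ae measurableT intf; apply: filterS => w /(_ I) fw.
apply: (@cvg_avg_squares _ (S^~ w)).
- by move=> n; exact: S0.
- move=> p q pq; rewrite /S (@big_cat_nat _ _ _ p.+1 1 q.+1)//= lerDl.
  by rewrite sumr_ge0.
apply/subr_cvg0; apply/norm_cvg0P.
have : D^~ w @ \oo --> (0 : R)%R.
  apply: cvg_series_cvg_0; apply: nondecreasing_is_cvgn.
    by apply/nondecreasing_seqP => n; rewrite seriesSr lerDl sqr_ge0.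
  exists (fine (f w)) => _ [n _ <-]; rewrite -lee_fin fineK//.
  by rewrite /series/= -sumEFin; apply: nneseries_lim_ge => k _ _; exact: D0.
move=> cD; have := cvg_comp _ _ cD (@sqrt_continuous R 0%R); rewrite sqrtr0.
by apply: cvg_trans; apply: near_eq_cvg; apply: nearW => k /=; rewrite /D sqrtr_sqr.
Qed.

End nonnegative.
End strong_law.

Section iid_law.
Context d d' (T : measurableType d) (T' : measurableType d') (R : realType).
Variables (P : probability T R) (X : nat -> {RV P >-> T'}).
Hypothesis indepX : mutually_independent X.
Hypothesis identX : identically_distributed X.
Local Open Scope ereal_scope.

Lemma ge0_integral_ident (f : T' -> R) j k : measurable_fun setT f ->
  (forall x, 0 <= f x)%R ->
  \int[P]_w (f (X j w))%:E = \int[P]_w (f (X k w))%:E.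
Proof.
move=> mf f0.
have mf' : measurable_fun setT (EFin \o f) by exact/measurable_EFinP.
have f0' x : 0 <= (EFin \o f) x by rewrite lee_fin.
rewrite -[LHS](ge0_integral_distribution (X j) mf' f0').
rewrite -[RHS](ge0_integral_distribution (X k) mf' f0').
by apply: eq_measure_integral => A mA _; exact: identX.
Qed.

Section pair.
Variables (j k : nat) (jk : j != k).

Definition pairX w := (X j w, X k w).

Let measurable_pairX : measurable_fun setT pairX.
Proof. exact/measurable_fun_pair. Qed.

HB.instance Definition _ := isMeasurableFun.Build _ _ _ _ pairX
  measurable_pairX.

Let pair_law A : measurable A ->
  (distribution P (X j) \x distribution P (X k)) A = pushforward P pairX A.
Proof.
apply: product_measure_unique => {}A B mA mB; rewrite /pushforward.
pose C i := if i == j then A else B.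
have mC i : measurable (C i) by rewrite /C; case: ifP.
have := indepX (J := [:: j; k]) (B := C).
rewrite /= inE jk => /(_ isT mC).
rewrite !big_cons big_nil mule1 /C eqxx eq_sym (negbTE jk) => <-.
congr (P _); apply/seteqP; split => w /=.
  by move=> [Aw Bw] i; rewrite /= !inE => /orP[] /eqP ->;
    rewrite ?eqxx// eq_sym (negbTE jk).
move=> h; split.
  by have := h j; rewrite /= !inE eqxx => /(_ isT).
by have := h k; rewrite /= !inE eqxx orbT eq_sym (negbTE jk) => /(_ isT).
Qed.

(** The pair (X j, X k) has the product law by uniqueness of product measures,
    and Tonelli's theorem separates the two factors. *)
Lemma ge0_integral_indep (f : T' -> R) : measurable_fun setT f ->
  (forall x, 0 <= f x)%R ->
  \int[P]_w (f (X j w) * f (X k w))%:E =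
  \int[P]_w (f (X j w))%:E * \int[P]_w (f (X k w))%:E.
Proof.
move=> mf f0; pose g z := (f z.1 * f z.2)%:E.
have mf' : measurable_fun setT (EFin \o f) by exact/measurable_EFinP.
have f0' x : 0 <= (EFin \o f) x by rewrite lee_fin.
have mg : measurable_fun setT g.
  by apply/measurable_EFinP; apply: measurable_funM; exact: measurableT_comp.
have g0 z : 0 <= g z by rewrite lee_fin mulr_ge0.
transitivity (\int[pushforward P pairX]_z g z).
  by rewrite ge0_integral_pushforward.
transitivity (\int[distribution P (X j) \x distribution P (X k)]_z g z).
  by apply: eq_measure_integral => A mA _; rewrite /= -pair_law.
rewrite fubini_tonelli1// /fubini_F /=.
under eq_integral.
  move=> x _.
  have -> : \int[distribution P (X k)]_y g (x, y) =
      (f x)%:E * \int[P]_w (f (X k w))%:E.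
    rewrite /g/=; under eq_integral do rewrite EFinM.
    rewrite ge0_integralZl_EFin//; last by move=> y _; exact: f0'.
    congr (_ * _).
    exact: (ge0_integral_distribution (X k) mf' f0').
  over.
rewrite ge0_integralZr//; last 2 first.
- by move=> x _; exact: f0'.
- by apply: integral_ge0 => w _; exact: f0'.
by congr (_ * _); exact: (ge0_integral_distribution (X j) mf' f0').
Qed.

End pair.

Let strong_law_iid_ge0 (f : T' -> R) : measurable_fun setT f ->
  (forall x, 0 <= f x)%R -> \int[P]_w (f (X 0%N w) ^+ 2)%:E < +oo ->
  {ae P, forall w, (fun n => (\sum_(1 <= j < n.+1) f (X j w)) / n%:R)%R @ \oo
    --> (\int[P]_w f (X 0%N w))%R}.
Proof.
move=> mf f0 f2.
have mf2 : measurable_fun setT (fun x => f x ^+ 2)%R by exact: measurable_funX.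
have f20 : 0 <= \int[P]_w (f (X 0%N w) ^+ 2)%:E.
  by apply: integral_ge0 => w _; rewrite lee_fin sqr_ge0.
have f10 : 0 <= \int[P]_w (f (X 0%N w))%:E.
  by apply: integral_ge0 => w _; rewrite lee_fin.
have f1 : \int[P]_w (f (X 0%N w))%:E < +oo.
  apply: (@le_lt_trans _ _ (\int[P]_w ((f (X 0%N w) ^+ 2)%:E + 1))).
    apply: ge0_le_integral => //.
    - by move=> w _; rewrite lee_fin.
    - by apply/measurable_EFinP; exact: measurableT_comp.
    - apply: emeasurable_funD => //; apply/measurable_EFinP.
      exact: (measurableT_comp mf2).
    - move=> w _; rewrite -EFinD lee_fin.
      by move: (f _) (f0 (X 0%N w)) => x x0; have := sqr_ge0 (x - 1)%R; nra.
  rewrite ge0_integralD//=.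
  - by rewrite integral_cst//= probability_setT mule1 lte_add_pinfty// ltry.
  - by move=> w _; rewrite lee_fin sqr_ge0.
  - by apply/measurable_EFinP; exact: (measurableT_comp mf2).
have f1fin : \int[P]_w (f (X 0%N w))%:E \is a fin_num by rewrite ge0_fin_numE.
apply: (@strong_law_ge0 _ _ _ _ (fun j w => f (X j w)) _
    (fine (\int[P]_w (f (X 0%N w) ^+ 2)%:E))).
- by move=> j; exact: measurableT_comp.
- by move=> j w; exact: f0.
- by move=> j; rewrite (ge0_integral_ident j 0%N)// fineK.
- move=> j; rewrite (ge0_integral_ident (f := fun x => f x ^+ 2)%R j 0%N)//.
    by rewrite fineK// ge0_fin_numE.
  by move=> x; exact: sqr_ge0.
- move=> j k jk; rewrite ge0_integral_indep//.
  by rewrite (ge0_integral_ident j 0%N)// (ge0_integral_ident k 0%N)// EFinM !fineK.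
Qed.

Lemma square_integrable (g : T -> R) : measurable_fun setT g ->
  \int[P]_w (g w ^+ 2)%:E < +oo -> P.-integrable setT (EFin \o g).
Proof.
move=> mg g2; apply/integrableP; split; first exact/measurable_EFinP.
apply: (@le_lt_trans _ _ (\int[P]_w ((g w ^+ 2)%:E + 1))).
  apply: ge0_le_integral => //.
  - by apply: measurableT_comp => //; exact/measurable_EFinP.
  - apply: emeasurable_funD => //; apply/measurable_EFinP.
    exact: measurable_funX.
  - move=> w _; rewrite -EFinD lee_fin.
    by rewrite -real_normK ?num_real//; have := normr_ge0 (g w);
      move: `|g w|%R => x x0; have := sqr_ge0 (x - 1)%R; nra.
rewrite ge0_integralD//=.
- by rewrite integral_cst//= probability_setT mule1 lte_add_pinfty// ltry.
- by move=> w _; rewrite lee_fin sqr_ge0.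
- by apply/measurable_EFinP; exact: measurable_funX.
Qed.

(** The positive and negative parts of f inherit the second moment, and the
    nonnegative case applies to each. *)
Lemma strong_law_iid (f : T' -> R) : measurable_fun setT f ->
  \int[P]_w (f (X 0%N w) ^+ 2)%:E < +oo ->
  {ae P, forall w, (fun n => (\sum_(1 <= j < n.+1) f (X j w)) / n%:R)%R @ \oo
    --> (\int[P]_w f (X 0%N w))%R}.
Proof.
move=> mf f2.
pose fp x := Num.max (f x) 0%R; pose fn x := Num.max (- f x)%R 0%R.
have mfp : measurable_fun setT fp by exact: measurable_maxr.
have mfn : measurable_fun setT fn.
  by apply: measurable_maxr => //; exact: measurableT_comp.
have fE x : f x = (fp x - fn x)%R.
  by rewrite /fp /fn; case: (ltP (f x) 0%R) => h; case: ltP => h'; lra.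
have mX (g : T' -> R) : measurable_fun setT g ->
  measurable_fun setT (fun w => g (X 0%N w)) by move=> mg; exact: measurableT_comp.
have bnd (g : T' -> R) : measurable_fun setT g ->
    (forall x, g x ^+ 2 <= f x ^+ 2)%R -> \int[P]_w (g (X 0%N w) ^+ 2)%:E < +oo.
  move=> mg gf; apply: le_lt_trans f2; apply: ge0_le_integral => //.
  - by move=> w _; rewrite lee_fin sqr_ge0.
  - by apply/measurable_EFinP; apply: measurable_funX; exact: mX.
  - by apply/measurable_EFinP; apply: measurable_funX; exact: mX.
  - by move=> w _; rewrite lee_fin.
have fp2 : \int[P]_w (fp (X 0%N w) ^+ 2)%:E < +oo.
  by apply: bnd => // x; rewrite /fp; case: (leP (f x) 0%R) => // _; rewrite expr0n sqr_ge0.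
have fn2 : \int[P]_w (fn (X 0%N w) ^+ 2)%:E < +oo.
  apply: bnd => // x; rewrite /fn; case: (leP (- f x)%R 0%R) => _.
    by rewrite expr0n sqr_ge0.
  by rewrite sqrrN.
have fp0 x : (0 <= fp x)%R by rewrite /fp le_max lexx orbT.
have fn0 x : (0 <= fn x)%R by rewrite /fn le_max lexx orbT.
have := strong_law_iid_ge0 mfn fn0 fn2.
have := strong_law_iid_ge0 mfp fp0 fp2.
apply: filterS2 => w hp hn.
have -> : (\int[P]_w f (X 0%N w) =
    \int[P]_w fp (X 0%N w) - \int[P]_w fn (X 0%N w))%R.
  rewrite -RintegralB//; last 2 first.
  - by apply: square_integrable => //; exact: mX.
  - by apply: square_integrable => //; exact: mX.
  by apply: eq_Rintegral => v _; exact: fE.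
rewrite (_ : (fun n => _) = (fun n =>
    (\sum_(1 <= j < n.+1) fp (X j w)) / n%:R -
    (\sum_(1 <= j < n.+1) fn (X j w)) / n%:R)%R); first exact: cvgB.
apply/funext => n; rewrite -mulrBl -sumrB; congr (_ / _)%R.
by apply: eq_bigr => j _; exact: fE.
Qed.

End iid_law.

(** * Lebesgue measure on column vectors: reflection and Gaussian integrals *)

Section measurability.
Context (R : realType) (d : nat).

Lemma measurable_entry i : measurable_fun setT (fun x : 'cV[R]_d => x i ord0).
Proof. exact: measurable_mx_entry. Qed.

Lemma measurable_dotv (y : 'cV[R]_d) : measurable_fun setT (fun t => dotv t y).
Proof.
under eq_fun do rewrite dotvE.
apply: measurable_sum => i; apply: measurable_funM => //.
exact: measurable_entry.
Qed.

Lemma measurable_dotvr (t : 'cV[R]_d) : measurable_fun setT (dotv t).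
Proof.
rewrite (_ : dotv t = fun x => dotv x t); first exact: measurable_dotv.
by apply/funext => x; rewrite dotvC.
Qed.

Lemma measurable_sqr_enorm :
  measurable_fun setT (fun t : 'cV[R]_d => enorm t ^+ 2).
Proof.
under eq_fun do rewrite sqr_enorm dotvE.
by apply: measurable_sum => i; apply: measurable_funM; exact: measurable_entry.
Qed.

Lemma measurable_enorm : measurable_fun setT (@enorm R d).
Proof.
rewrite (_ : @enorm R d = Num.sqrt \o (fun t => enorm t ^+ 2)); last first.
  by apply/funext => t; rewrite /= sqrtr_sqr ger0_norm// enorm_ge0.
apply: measurableT_comp; last exact: measurable_sqr_enorm.
exact: continuous_measurable_fun (@sqrt_continuous R).
Qed.

Lemma measurable_gauss_weight (a : R) :
  measurable_fun setT (@gauss_weight R d a).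
Proof.
apply: measurableT_comp; first exact: measurable_expR.
by apply: measurable_funM => //; exact: measurable_sqr_enorm.
Qed.

Lemma measurable_oppv : measurable_fun setT (fun t : 'cV[R]_d => - t).
Proof.
apply: measurable_fun_mxP => i j; rewrite (ord1 j).
under eq_fun do rewrite mxE.
by apply: measurableT_comp => //; exact: measurable_entry.
Qed.

End measurability.

Section lebesgue_cV_theory.
Context (R : realType).
Local Open Scope ereal_scope.
Notation mu := (@lebesgue_measure R).

Lemma integral_lebesgue_cVS d (f : 'cV[R]_d.+1 -> \bar R) :
  measurable_fun setT f -> (forall t, 0 <= f t) ->
  \int[lebesgue_cV R d.+1]_t f t =
  \int[mu]_x \int[lebesgue_cV R d]_v f (cons_cV (x, v)).
Proof.
move=> mf f0.
transitivity (\int[(mu \x lebesgue_cV R d)]_z f (cons_cV z)).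
  by rewrite /= ge0_integral_pushforward.
rewrite fubini_tonelli1//.
by apply: measurableT_comp => //; exact: measurable_cons_cV.
Qed.

Lemma measurable_section_cons d (f : 'cV[R]_d.+1 -> \bar R) x :
  measurable_fun setT f -> measurable_fun setT (fun v => f (cons_cV (x, v))).
Proof.
move=> mf; apply: measurableT_comp => //.
by apply: measurableT_comp => //; exact: measurable_cons_cV.
Qed.

Let opp (x : measurableTypeR R) : measurableTypeR R := (- x)%R.

Let measurable_opp : measurable_fun setT opp.
Proof. exact: oppr_measurable. Qed.

HB.instance Definition _ := isMeasurableFun.Build _ _ _ _ opp measurable_opp.

(** The reflected measure agrees with Lebesgue measure on intervals, up to
    their endpoints. *)
Lemma ge0_integral_lebesgueN (g : R -> \bar R) : measurable_fun setT g ->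
  (forall x, 0 <= g x) -> \int[mu]_x g (- x)%R = \int[mu]_x g x.
Proof.
move=> mg g0.
transitivity (\int[pushforward mu opp]_x g x).
  by rewrite ge0_integral_pushforward.
apply: eq_measure_integral => A mA _; apply/esym.
apply: (lebesgue_measure_unique (mu := pushforward mu opp)) mA.
move=> _ [[x y] /= xy <-]; rewrite /pushforward.
have -> : opp @^-1` `]x, y] = `[(- y)%R, (- x)%R[%classic.
  by apply/seteqP; split => z /=; rewrite /opp !in_itv/= => /andP[h1 h2];
    apply/andP; split; lra.
rewrite !lebesgue_measure_itv/= !lte_fin ltrN2; case: ifP => // _.
by rewrite -!EFinD opprK addrC.
Qed.

Lemma ge0_integral_lebesgue_cVN d (f : 'cV[R]_d -> \bar R) :
  measurable_fun setT f -> (forall t, 0 <= f t) ->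
  \int[lebesgue_cV R d]_t f (- t)%R = \int[lebesgue_cV R d]_t f t.
Proof.
elim: d f => [|d ih] f mf f0.
  by apply: eq_integral => t _; rewrite (flatmx0 (- t)%R) (flatmx0 t).
rewrite !integral_lebesgue_cVS//; last first.
  by apply: measurableT_comp => //; exact: measurable_oppv.
pose F x := \int[lebesgue_cV R d]_v f (cons_cV (x, v)).
rewrite -[RHS](ge0_integral_lebesgueN (g := F)).
- apply: eq_integral => x _; rewrite /F -[RHS]ih.
  + apply: eq_integral => v _; congr f; apply/colP => i; rewrite !mxE/=.
    by case: (unlift ord0 i) => //= j; rewrite mxE.
  + exact: measurable_section_cons.
  + by move=> t; exact: f0.
- apply: (@measurable_fun_fubini_tonelli_F _ _ _ _ _ _ (fun z => f (cons_cV z))) => //.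
  by apply: measurableT_comp => //; exact: measurable_cons_cV.
- by move=> x; apply: integral_ge0 => v _; exact: f0.
Qed.

Lemma integral_gauss_lt (b : R) : (0 < b)%R ->
  \int[mu]_x (expR (- b * x ^+ 2))%:E < +oo.
Proof.
(* the variance for which the normal density is proportional to the integrand *)
move=> b0; pose s := Num.sqrt (2 * b)^-1.
have s2 : (s ^+ 2 = (2 * b)^-1)%R by rewrite sqr_sqrtr// invr_ge0 mulr_ge0// ltW.
have s0 : s != 0%R.
  by rewrite gt_eqF// sqrtr_gt0 invr_gt0 mulr_gt0.
have p0 := normal_peak_gt0 s0.
have E x : (expR (- b * x ^+ 2))%:E = (normal_peak s)^-1%:E * (normal_pdf 0 s x)%:E.
  rewrite -EFinM normal_pdfE//=; congr (_%:E); rewrite mulKf ?gt_eqF// /normal_fun.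
  congr (expR _); rewrite subr0 s2.
  have b1 : b != 0%R by rewrite gt_eqF.
  by field.
under eq_integral do rewrite E.
rewrite ge0_integralZl_EFin//; last 3 first.
- by move=> x _; rewrite lee_fin normal_pdf_ge0.
- by apply/measurable_EFinP; exact: measurable_normal_pdf.
- by rewrite invr_ge0 ltW.
by rewrite integral_normal_pdf// mule1 ltry.
Qed.

Lemma integral_gauss_weight_lt d (b : R) : (0 < b)%R ->
  \int[lebesgue_cV R d]_t (gauss_weight b t)%:E < +oo.
Proof.
move=> b0; elim: d => [|d ih].
  rewrite integral_dirac//= ?diracT ?mul1e ?ltry//.
  by apply/measurable_EFinP; exact: measurable_gauss_weight.
rewrite integral_lebesgue_cVS//; last 2 first.
- by apply/measurable_EFinP; exact: measurable_gauss_weight.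
- by move=> t; rewrite lee_fin expR_ge0.
have E x v : (gauss_weight b (cons_cV (x, v)))%:E =
    (expR (- b * x ^+ 2))%:E * (gauss_weight b v)%:E.
  rewrite -EFinM /gauss_weight -expRD -mulrDr !sqr_enorm !dotvE big_ord_recl.
  rewrite cons_cV0 -expr2; congr (expR (_ * (_ + _)))%:E.
  by apply: eq_bigr => i _; rewrite cons_cVS.
under eq_integral.
  move=> x _; under eq_integral do rewrite E.
  rewrite ge0_integralZl_EFin//; last 2 first.
  - by move=> v _; rewrite lee_fin expR_ge0.
  - by apply/measurable_EFinP; exact: measurable_gauss_weight.
  over.
have g0 : 0 <= \int[lebesgue_cV R d]_t (gauss_weight b t)%:E.
  by apply: integral_ge0 => v _; rewrite lee_fin expR_ge0.
rewrite ge0_integralZr//=; last first.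
  apply/measurable_EFinP; apply: measurableT_comp; first exact: measurable_expR.
  by apply: measurable_funM => //; exact: measurable_funX.
apply: lte_mul_pinfty; last exact: ih.
  by apply: integral_ge0 => v _; rewrite lee_fin expR_ge0.
rewrite ge0_fin_numE ?integral_gauss_lt//.
by apply: integral_ge0 => v _; rewrite lee_fin expR_ge0.
Qed.

(** The growth of a polynomial in |t|^2 costs only half of the Gaussian
    exponent. *)
Lemma gauss_weight_growth d (a K : R) (t : 'cV[R]_d) : (0 < a)%R -> (0 <= K)%R ->
  ((K + enorm t ^+ 2) ^+ 2 * gauss_weight a t <=
   (K + 4 / a) ^+ 2 * gauss_weight (a / 2) t)%R.
Proof.
move=> a0 K0; rewrite /gauss_weight; set u := (enorm t ^+ 2)%R.
have u0 : (0 <= u)%R by exact: sqr_ge0.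
have -> : (- a * u = - (a / 2) * u + (- (a / 4 * u) - a / 4 * u))%R by field.
rewrite !expRD -expr2.
rewrite mulrCA [leRHS]mulrC ler_wpM2l ?expR_ge0//.
rewrite -exprMn ler_pXn2r ?nnegrE ?mulr_ge0 ?addr_ge0 ?expR_ge0 ?divr_ge0//;
  last 1 first.
- exact: ltW.
rewrite expRN ler_pdivrMr ?expR_gt0//.
apply: (@le_trans _ _ ((K + 4 / a) * (1 + a / 4 * u))%R); last first.
  by rewrite ler_wpM2l ?expR_ge1Dx// addr_ge0// divr_ge0// ltW.
have -> : ((K + 4 / a) * (1 + a / 4 * u) = K + u + (4 / a + K * (a / 4 * u)))%R.
  by field; rewrite gt_eqF.
have a4 : (0 <= a / 4 * u)%R by rewrite mulr_ge0// divr_ge0// ltW.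
rewrite lerDl; apply: addr_ge0; last exact: mulr_ge0.
by rewrite divr_ge0// ltW.
Qed.

End lebesgue_cV_theory.

(** * Laplacians of trigonometric sums and of trigonometric means *)

Section directional_derivative.
Context (R : realType) (d : nat).

Lemma is_derive_line (f : 'cV[R]_d -> R) t v l :
  is_derive (0 : R) 1 (fun h => f (h *: v + t)) l -> is_derive t v f l.
Proof.
move=> [dg gl].
have E : (fun h : R => h^-1 *: (f (h *: v + t) - f t)) =
    (fun h : R => h^-1 *: (f ((h *: 1 + 0) *: v + t) - f (0 *: v + t))).
  by apply/funext => h; rewrite scaler1 addr0 scale0r add0r.
by split; [rewrite /derivable E|rewrite -gl /derive E].
Qed.

Lemma is_derive1_affine (tau tau' : R -> R) (b c h : R) :
  (forall u : R, is_derive u 1 tau (tau' u)) ->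
  is_derive h 1 (fun k => tau (k * b + c)) (b * tau' (h * b + c)).
Proof.
move=> dtau.
have aff : is_derive h 1 (fun k : R => k * b + c) b.
  rewrite (_ : (fun k : R => k * b + c) = b \*: id + cst c); last first.
    by apply/funext => k; rewrite mulrC.
  by apply: is_derive_eq; rewrite [b *: 1]mulr1 addr0.
have := @is_derive1_comp _ tau (fun k => k * b + c) h _ _ (dtau _) aff.
by rewrite mulrC.
Qed.

Lemma is_derive_dotv (tau tau' : R -> R) (t v x : 'cV[R]_d) :
  (forall u : R, is_derive u 1 tau (tau' u)) ->
  is_derive t v (fun s => tau (dotv s x)) (dotv v x * tau' (dotv t x)).
Proof.
move=> dtau; apply: is_derive_line.
under [X in is_derive _ _ X _]eq_fun do rewrite dotvDl dotvZl.
have := is_derive1_affine (dotv v x) (dotv t x) 0 dtau.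
by rewrite mul0r add0r.
Qed.

Lemma is_derive_sum_seq (I : Type) (r : seq I) (h : I -> 'cV[R]_d -> R)
    (dh : I -> R) t v :
  (forall i, is_derive t v (h i) (dh i)) ->
  is_derive t v (fun s => \sum_(i <- r) h i s) (\sum_(i <- r) dh i).
Proof.
move=> hd; elim: r => [|i r ih].
  rewrite big_nil; under [X in is_derive _ _ X _]eq_fun do rewrite big_nil.
  exact: is_derive_cst.
rewrite big_cons; under [X in is_derive _ _ X _]eq_fun do rewrite big_cons.
exact: is_deriveD.
Qed.

Lemma dotv_delta i (x : 'cV[R]_d) : dotv (delta_mx i ord0) x = x i ord0.
Proof.
rewrite dotvE (bigD1 i)//= mxE !eqxx mul1r big1 ?addr0// => j ji.
by rewrite mxE (negbTE ji) mul0r.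
Qed.

Lemma laplacian_from_derive (f : 'cV[R]_d -> R) (g : 'I_d -> 'cV[R]_d -> R)
    (h : 'I_d -> R) t :
  (forall i s, is_derive s (delta_mx i ord0) f (g i s)) ->
  (forall i, is_derive t (delta_mx i ord0) (g i) (h i)) ->
  laplacian f t = \sum_i h i.
Proof.
move=> fg gh; apply: eq_bigr => i _.
have -> : 'D_(delta_mx i ord0) f = g i.
  by apply/funext => s; exact: derive_val.
exact: derive_val.
Qed.

Lemma laplacian_trig_sum (tau tau' : R -> R) (k : R) (I : Type) (r : seq I)
    (y : I -> 'cV[R]_d) t :
  (forall u : R, is_derive u 1 tau (tau' u)) ->
  (forall u : R, is_derive u 1 tau' (- tau u)) ->
  laplacian (fun s => k * \sum_(j <- r) tau (dotv s (y j))) t =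
  - (k * \sum_(j <- r) enorm (y j) ^+ 2 * tau (dotv t (y j))).
Proof.
move=> d1 d2.
have D1 i s : is_derive s (delta_mx i ord0)
    (fun s => k * \sum_(j <- r) tau (dotv s (y j)))
    (k * \sum_(j <- r) y j i ord0 * tau' (dotv s (y j))).
  apply: is_deriveZ; apply: is_derive_sum_seq => j.
  by rewrite -dotv_delta; exact: is_derive_dotv.
have D2 i : is_derive t (delta_mx i ord0)
    (fun s => k * \sum_(j <- r) y j i ord0 * tau' (dotv s (y j)))
    (k * \sum_(j <- r) y j i ord0 * (y j i ord0 * - tau (dotv t (y j)))).
  apply: is_deriveZ; apply: is_derive_sum_seq => j.
  apply: is_deriveZ.
  by rewrite -[X in X * - _]dotv_delta; apply: is_derive_dotv.
rewrite (laplacian_from_derive D1 D2) -mulr_sumr exchange_big/= -mulrN.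
rewrite -sumrN; congr (_ * _); apply: eq_bigr => j _.
rewrite sqr_enorm (dotvE (y j)) mulr_suml -sumrN; apply: eq_bigr => i _.
by rewrite !mulrN mulrA.
Qed.

End directional_derivative.

Section derivative_of_expectation.
Context (R : realType) (d : nat) disp (T : measurableType disp).
Context (P : probability T R) (X : {RV P >-> 'cV[R]_d}).

Lemma measurable_entry_RV i : measurable_fun setT (fun w => X w i ord0).
Proof. exact: (measurableT_comp (measurable_entry i)). Qed.

Lemma measurable_trig (tau tau' : R -> R) t :
  (forall u : R, is_derive u 1 tau (tau' u)) ->
  measurable_fun setT (fun w => tau (dotv t (X w))).
Proof.
move=> dtau; apply: measurableT_comp.
  apply: continuous_measurable_fun => u.
  by apply: differentiable_continuous; apply/derivable1_diffP; case: (dtau u).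
exact: (measurableT_comp (measurable_dotvr t)).
Qed.

Lemma integrable_bounded_factor (W V : T -> R) (M : R) :
  P.-integrable setT (EFin \o W) -> measurable_fun setT V ->
  (forall w, `|V w| <= M) -> P.-integrable setT (EFin \o (fun w => W w * V w)).
Proof.
move=> iW mV VM; apply: (@le_integrable _ _ _ _ _ measurableT _
    (EFin \o (fun w => M * W w))).
- by apply/measurable_EFinP; apply: measurable_funM => //;
    have /integrableP[/measurable_EFinP] := iW.
- move=> w _; rewrite /= lee_fin !normrM mulrC ler_wpM2r//.
  by rewrite (le_trans (VM w))// ler_norm.
- under [X in _.-integrable _ X]eq_fun do rewrite /= EFinM.
  exact: integrableZl.
Qed.

Lemma Rintegral_sum_seq (I : Type) (r : seq I) (f : I -> T -> R) :
  (forall i, P.-integrable setT (EFin \o f i)) ->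
  \int[P]_w (\sum_(i <- r) f i w) = \sum_(i <- r) \int[P]_w f i w.
Proof.
move=> intf.
have ints s : P.-integrable setT (EFin \o (fun w => \sum_(i <- s) f i w)).
  rewrite (_ : EFin \o _ = (fun w => \sum_(i <- s) (EFin \o f i) w)%E).
    exact: integrable_sum.
  by apply/funext => w; rewrite /= sumEFin.
elim: r => [|i r ih].
  by rewrite big_nil; under eq_Rintegral do rewrite big_nil; rewrite Rintegral_cst// mul0r.
by rewrite big_cons -ih -RintegralD//; under eq_Rintegral do rewrite big_cons.
Qed.

(** The derivative of h |-> W tau(h X_i + t.X) is bounded by 2 |X_i W| for all
    h, so it may be taken inside the expectation.  The constant 2 makes room for
    tau = cos + sin. *)
Lemma is_derive_expectation (tau tau' : R -> R) (W : T -> R) i t :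
  (forall u : R, is_derive u 1 tau (tau' u)) -> measurable_fun setT tau' ->
  (forall u, `|tau u| <= 2) -> (forall u, `|tau' u| <= 2) ->
  P.-integrable setT (EFin \o W) ->
  P.-integrable setT (EFin \o (fun w => X w i ord0 * W w)) ->
  is_derive t (delta_mx i ord0) (fun s => \int[P]_w (W w * tau (dotv s (X w))))
    (\int[P]_w ((X w i ord0 * W w) * tau' (dotv t (X w)))).
Proof.
move=> dtau mtau' btau btau' iW iXW; apply: is_derive_line.
pose f (h : R) w := W w * tau (h * X w i ord0 + dotv t (X w)).
have fE : (fun h => \int[P]_w (W w * tau (dotv (h *: delta_mx i ord0 + t) (X w))))
    = (fun h => \int[P]_w f h w).
  by apply/funext => h; apply: eq_Rintegral => w _; rewrite dotvDl dotvZl dotv_delta.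
rewrite fE.
have d1f (h : R) w : is_derive h 1 (f ^~ w)
    (W w * (X w i ord0 * tau' (h * X w i ord0 + dotv t (X w)))).
  exact/is_deriveZ/is_derive1_affine.
have d1E h w : partial1of2 f h w =
    W w * (X w i ord0 * tau' (h * X w i ord0 + dotv t (X w))).
  by rewrite /partial1of2 derive1E; exact: derive_val.
have I0 : [set` `]-1, 1[%R] (0 : R) by rewrite /= in_itv/=; lra.
have intf h : [set` `]-1, 1[%R] h -> P.-integrable setT (EFin \o f h).
  move=> _; apply: (@integrable_bounded_factor _ _ 2) => //.
  rewrite (_ : (fun _ => _) =
    (fun w => tau (dotv (h *: delta_mx i ord0 + t) (X w)))).
    exact: measurable_trig dtau.
  by apply/funext => w; rewrite dotvDl dotvZl dotv_delta.
have derf h w : [set` `]-1, 1[%R] h -> setT w -> derivable (f ^~ w) h 1.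
  by move=> _ _; case: (d1f h w).
have G0 w : 0 <= 2 * `|X w i ord0 * W w| by rewrite mulr_ge0.
have iG : P.-integrable setT (EFin \o (fun w => 2 * `|X w i ord0 * W w|)).
  under [X in _.-integrable _ X]eq_fun do rewrite /= EFinM.
  by apply: integrableZl => //; exact: (integrable_norm iXW).
have Gb h w : [set` `]-1, 1[%R] h -> setT w ->
    `|partial1of2 f h w| <= 2 * `|X w i ord0 * W w|.
  move=> _ _; rewrite d1E mulrA (mulrC (W w)) (normrM (_ * _)).
  by rewrite [leLHS]mulrC ler_wpM2r.
split.
  exact: (derivable_under_integral measurableT I0 intf derf G0 iG Gb).
rewrite -derive1E.
rewrite (differentiation_under_integral measurableT I0 intf derf G0 iG Gb).
apply: eq_Rintegral => w _; rewrite d1E mul0r add0r; ring.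
Qed.

Lemma laplacian_expectation (tau tau' : R -> R) t :
  (forall u : R, is_derive u 1 tau (tau' u)) ->
  (forall u : R, is_derive u 1 tau' (- tau u)) ->
  (forall u, `|tau u| <= 2) -> (forall u, `|tau' u| <= 2) ->
  (forall i, P.-integrable setT (EFin \o (fun w => X w i ord0))) ->
  (forall i, P.-integrable setT (EFin \o (fun w => X w i ord0 * X w i ord0))) ->
  laplacian (fun s => \int[P]_w tau (dotv s (X w))) t =
  - \int[P]_w (enorm (X w) ^+ 2 * tau (dotv t (X w))).
Proof.
move=> d1 d2 b1 b2 iX iXX.
have mder (f g : R -> R) : (forall u : R, is_derive u 1 f (g u)) -> measurable_fun setT f.
  move=> df; apply: continuous_measurable_fun => u.
  by apply: differentiable_continuous; apply/derivable1_diffP; case: (df u).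
have D1 i s : is_derive s (delta_mx i ord0)
    (fun s => \int[P]_w tau (dotv s (X w)))
    (\int[P]_w (X w i ord0 * tau' (dotv s (X w)))).
  have := @is_derive_expectation tau tau' (cst 1) i s d1 (mder _ _ d2) b1 b2.
  under [X in is_derive _ _ X _]eq_fun do under eq_Rintegral do rewrite mul1r.
  under [X in is_derive _ _ _ X]eq_Rintegral do rewrite mulr1.
  apply; first exact: finite_measure_integrable_cst.
  rewrite (_ : _ \o _ = EFin \o (fun w => X w i ord0))//.
  by apply/funext => w; rewrite /= mulr1.
have D2 i : is_derive t (delta_mx i ord0)
    (fun s => \int[P]_w (X w i ord0 * tau' (dotv s (X w))))
    (\int[P]_w (X w i ord0 * X w i ord0 * - tau (dotv t (X w)))).
  apply: (@is_derive_expectation tau' (fun u => - tau u)) => //.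
  - by apply: measurableT_comp => //; exact: mder d1.
  - by move=> u; rewrite normrN.
rewrite (laplacian_from_derive D1 D2).
rewrite -Rintegral_sum_seq; last first.
  move=> i; apply: (@integrable_bounded_factor _ _ 2) => //.
    by apply: measurableT_comp => //; exact: measurable_trig d1.
  by move=> w; rewrite normrN.
have iXX2 : P.-integrable setT (EFin \o (fun w => enorm (X w) ^+ 2)).
  rewrite (_ : EFin \o _ =
    (fun w => \sum_i (X w i ord0 * X w i ord0)%R%:E)%E).
    by apply: integrable_sum => // i _; exact: iXX.
  by apply/funext => w; rewrite /= sqr_enorm dotvE sumEFin.
rewrite -mulN1r -RintegralZl//; last first.
  apply: (@integrable_bounded_factor _ _ 2) => //.
  exact: measurable_trig d1.
apply: eq_Rintegral => w _; rewrite mulN1r sqr_enorm (dotvE (X w)) mulr_suml -sumrN.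
by apply: eq_bigr => i _; rewrite mulrN.
Qed.

End derivative_of_expectation.

(** * The scaled residuals approach the observations *)

Section averages.
Context (R : realType).
Implicit Types u v : nat -> R.

Definition avg u (n : nat) : R := (\sum_(1 <= j < n.+1) u j) / n%:R.

Lemma avgD u v n : avg (fun j => u j + v j) n = avg u n + avg v n.
Proof. by rewrite /avg big_split/= mulrDl. Qed.

Lemma avgZ k u n : avg (fun j => k * u j) n = k * avg u n.
Proof. by rewrite /avg -mulr_sumr mulrA. Qed.

Lemma avgN u n : avg (fun j => - u j) n = - avg u n.
Proof. by rewrite /avg sumrN mulNr. Qed.

Lemma avgB u v n : avg (fun j => u j - v j) n = avg u n - avg v n.
Proof. by rewrite avgD avgN. Qed.

Lemma avg_cst k n : (0 < n)%N -> avg (fun=> k) n = k.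
Proof.
move=> n0; rewrite /avg sumr_const_nat subn1/= -[k *+ n]mulr_natr mulfK//.
by rewrite pnatr_eq0 -lt0n.
Qed.

Lemma avg_sum (I : finType) (u : I -> nat -> R) n :
  avg (fun j => \sum_i u i j) n = \sum_i avg (u i) n.
Proof. by rewrite /avg exchange_big/= mulr_suml. Qed.

Lemma ler_avg u v n : (forall j, u j <= v j) -> avg u n <= avg v n.
Proof. by move=> uv; rewrite ler_wpM2r ?invr_ge0// ler_sum. Qed.

Lemma ler_norm_avg u n : `|avg u n| <= avg (fun j => `|u j|) n.
Proof.
rewrite /avg normrM (ger0_norm (x := n%:R^-1)) ?invr_ge0// ler_wpM2r ?invr_ge0//.
exact: ler_norm_sum.
Qed.

Lemma cvg_sum_ord m (u : 'I_m -> nat -> R) (l : 'I_m -> R) :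
  (forall i, u i @ \oo --> l i) ->
  (fun n => \sum_i u i n) @ \oo --> \sum_i l i.
Proof. by move=> ul; apply: cvg_big => //; exact: add_continuous. Qed.

End averages.

Section near_identity.
Context (R : realType) (d : nat).
Implicit Types (B N S : 'M[R]_d) (v x : 'cV[R]_d).

Lemma ler_enorm_posdefD1 B v : posdefmx B -> enorm v <= enorm (B *m v + v).
Proof.
move=> [_ Bpos]; rewrite -(ler_pXn2r (n := 2))// ?nnegrE ?enorm_ge0//.
rewrite !sqr_enorm dotvDl !dotvDr (dotvC (B *m v) v).
have : 0 <= dotv v (B *m v).
  have [->|/Bpos/ltW//] := eqVneq v 0; by rewrite mulmx0 dotv0r.
have := dotvv_ge0 (B *m v); lra.
Qed.

Lemma posdef_unitmx S : posdefmx S -> S \in unitmx.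
Proof.
move=> [ST Spos]; rewrite unitmxE unitfE; apply/det0P => -[v v0 vS].
have v0' : v^T != 0 by rewrite -trmx0 (inj_eq trmx_inj).
have := Spos _ v0'; rewrite -{1}ST -trmx_mul vS trmx0 dotv0r ltxx.
by [].
Qed.

Lemma posdef_invmx S : posdefmx S -> posdefmx (invmx S).
Proof.
move=> Spd; have Su := posdef_unitmx Spd; case: Spd => ST Spos.
split; first by rewrite trmx_inv ST.
move=> x x0; rewrite -{1}(mulKVmx Su x) dotvC; apply: Spos.
by apply: contra x0 => /eqP h; rewrite -(mulKVmx Su x) h mulmx0.
Qed.

Lemma posdef_near1 S : S^T = S -> mxsum1 (S - 1%:M) < 1 -> posdefmx S.
Proof.
move=> ST S1; split => // x x0.
have xx : 0 < dotv x x by rewrite lt_neqAle eq_sym dotvv_eq0 x0 dotvv_ge0.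
have -> : S *m x = x + (S - 1%:M) *m x by rewrite mulmxBl mul1mx subrKC.
rewrite dotvDr.
have := ler_dotv x ((S - 1%:M) *m x).
have := ler_wpM2l (enorm_ge0 x) (ler_enorm_mulmx (S - 1%:M) x).
rewrite mulrCA -expr2 sqr_enorm ler_norml => h /andP[h1 _].
have : mxsum1 (S - 1%:M) * dotv x x < dotv x x by rewrite gtr_pMl.
lra.
Qed.

(** If B is the positive definite root of S^-1, then
    (B + 1)(B - 1) = S^-1 - 1 and |(B + 1)w| >= |w|; so B - 1 is controlled by
    S^-1 - 1, hence by S - 1, without any continuity of the root. *)
Lemma sqrt_invmx_near1 S v : S^T = S -> mxsum1 (S - 1%:M) <= 2^-1 ->
  enorm (sqrtmx (invmx S) *m v - v) <= 2 * mxsum1 (S - 1%:M) * enorm v.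
Proof.
move=> ST S1; set e := mxsum1 _ in S1 *.
have Spd : posdefmx S by apply: posdef_near1 => //; rewrite (le_lt_trans S1)// invf_lt1// ltr1n.
have Su := posdef_unitmx Spd.
have [Bpd BB] := sqrtmxP (posdef_invmx Spd).
move: Bpd BB; move: (sqrtmx _) => B Bpd BB.
apply: (le_trans (ler_enorm_posdefD1 (B *m v - v) Bpd)).
rewrite mulmxBr mulmxA BB addrA subrK.
set u := invmx S *m v.
have vE : v = S *m u by rewrite mulKVmx.
have h1 : enorm (u - v) <= e * enorm u.
  rewrite -enormN opprB {1}vE.
  have -> : S *m u - u = (S - 1%:M) *m u by rewrite mulmxBl mul1mx.
  exact: ler_enorm_mulmx.
have h2 : enorm u <= enorm (u - v) + enorm v.
  by rewrite -{1}(subrK v u) ler_enormD.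
have h3 : e * enorm u <= 2^-1 * enorm u by rewrite ler_wpM2r// enorm_ge0.
have h4 : enorm u <= 2 * enorm v by move: h1 h2 h3; lra.
by apply: (le_trans h1); rewrite -[leRHS]mulrA [leRHS]mulrCA ler_wpM2l// mxsum1_ge0.
Qed.

End near_identity.

Section residuals.
Context (R : realType) (d : nat) (x : nat -> 'cV[R]_d).
Hypothesis mean0 : forall i, avg (fun j => x j i ord0) @ \oo --> (0 : R).
Hypothesis cov1 : forall i k, avg (fun j => x j i ord0 * x j k ord0) @ \oo -->
  ((1%:M : 'M[R]_d) i k).

Lemma sample_meanE n i : sample_mean n x i ord0 = avg (fun j => x j i ord0) n.
Proof. by rewrite /sample_mean mxE summxE mulrC. Qed.

Lemma sample_cov_sym n : (sample_cov n x)^T = sample_cov n x.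
Proof.
rewrite /sample_cov linearZ/= linear_sum/=; congr (_ *: _).
by apply: eq_bigr => j _; rewrite trmx_mul trmxK.
Qed.

Lemma sample_covE n i k : (0 < n)%N -> sample_cov n x i k =
  avg (fun j => x j i ord0 * x j k ord0) n -
  avg (fun j => x j i ord0) n * avg (fun j => x j k ord0) n.
Proof.
move=> n0; rewrite -!sample_meanE.
have -> : sample_cov n x i k = avg (fun j =>
    (x j i ord0 - sample_mean n x i ord0) *
    (x j k ord0 - sample_mean n x k ord0)) n.
  rewrite /sample_cov mxE summxE mulrC; congr (_ * _); apply: eq_bigr => j _.
  by rewrite mxE big_ord1 !mxE.
set p := sample_mean n x i ord0; set q := sample_mean n x k ord0.
under [X in avg X _]eq_fun do rewrite mulrBl !mulrBr opprB (mulrC _ q) addrA.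
rewrite !(avgB, avgD, avgZ) avg_cst// -!sample_meanE -/p -/q; ring.
Qed.

Lemma cvg_mean_norm : (fun n => enorm (sample_mean n x)) @ \oo --> (0 : R).
Proof.
have h : (fun n => \sum_i `|sample_mean n x i ord0|) @ \oo --> (0 : R).
  rewrite -[X in _ --> X](@big1 R 0 +%R 'I_d (index_enum 'I_d) xpredT (fun=> 0) (fun _ _ => erefl)).
  apply: cvg_sum_ord => i; rewrite -(@normr0 _ R); apply: cvg_norm.
  by under eq_fun do rewrite sample_meanE; exact: mean0.
apply: (squeeze_cvgr _ (cvg_cst 0) h); apply: nearW => n.
by rewrite enorm_ge0 ler_enorm_sum.
Qed.

Lemma cvg_cov_near1 : (fun n => mxsum1 (sample_cov n x - 1%:M)) @ \oo --> (0 : R).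
Proof.
rewrite /mxsum1 -[X in _ --> X](@big1 R 0 +%R 'I_d (index_enum 'I_d) xpredT (fun=> 0) (fun _ _ => erefl)).
apply: cvg_sum_ord => i.
rewrite -[X in _ --> X](@big1 R 0 +%R 'I_d (index_enum 'I_d) xpredT (fun=> 0) (fun _ _ => erefl)).
apply: cvg_sum_ord => k; rewrite -(@normr0 _ R); apply: cvg_norm.
have : (fun n => avg (fun j => x j i ord0 * x j k ord0) n -
  avg (fun j => x j i ord0) n * avg (fun j => x j k ord0) n -
  (1%:M : 'M[R]_d) i k) @ \oo --> ((1%:M : 'M[R]_d) i k - 0 * 0 - (1%:M : 'M[R]_d) i k).
  apply: cvgB; last exact: cvg_cst.
  by apply: cvgB => //; apply: cvgM.
rewrite mul0r subr0 subrr; apply: cvg_trans; apply: near_eq_cvg; near=> n.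
have -> : (sample_cov n x - 1%:M) i k = sample_cov n x i k - (1%:M : 'M[R]_d) i k.
  by rewrite [LHS]mxE [X in _ + X]mxE.
rewrite sample_covE//.
by near: n; exact: nbhs_infty_gt.
Unshelve. all: end_near. Qed.

(** Y_j - x_j = (B - 1)(x_j - m) - m, with m the sample mean and B the root of
    the inverse sample covariance; the closeness has to be uniform in j and can
    only be relative to 1 + |x_j|. *)
Lemma scaled_residual_close (e : R) : 0 < e ->
  \forall n \near \oo, forall j,
    enorm (scaled_residual n x j - x j) <= e * (1 + enorm (x j)).
Proof.
move=> e0.
have /cvgr0_norm_le hm := cvg_mean_norm.
have /cvgr0_norm_le hc := cvg_cov_near1.
near=> n.
have m1 : enorm (sample_mean n x) <= e / 2.
  rewrite (le_trans (ler_norm _))//; near: n; apply: hm; lra.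
have S1 : mxsum1 (sample_cov n x - 1%:M) <= Num.min (2^-1) (e / 2).
  rewrite (le_trans (ler_norm _))//; near: n; apply: hc.
  rewrite lt_min; apply/andP; split; lra.
move=> j; rewrite /scaled_residual; move: m1 S1.
set m := sample_mean n x; set S := sample_cov n x.
rewrite le_min => m1 /andP[S1 S2].
have := sqrt_invmx_near1 (x j - m) (sample_cov_sym n) S1.
set B := sqrtmx _ => h.
have -> : B *m (x j - m) - x j = (B *m (x j - m) - (x j - m)) - m.
  by rewrite opprB addrAC subrKA.
apply: (le_trans (ler_enormB _ _)).
have h2 := ler_enormB (x j) m.
have := enorm_ge0 (x j - m); have := enorm_ge0 (x j); have := enorm_ge0 m.
have := mxsum1_ge0 (S - 1%:M).
move: h h2 S1 S2 m1; rewrite -/S.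
move: (mxsum1 _) (enorm (x j - m)) (enorm (x j)) (enorm m) (enorm _).
move=> s u r p b *.
have : 2 * s * u <= 2 * s * (r + p) by rewrite ler_wpM2l//; lra.
have : 2 * s * r <= e * r by rewrite ler_wpM2r//; lra.
have : 2 * s * p <= 1 * p by rewrite ler_wpM2r//; lra.
lra.
Unshelve. all: end_near. Qed.

Lemma cvg_avg_sqr_enorm : avg (fun j => enorm (x j) ^+ 2) @ \oo --> (d%:R : R).
Proof.
have -> : avg (fun j => enorm (x j) ^+ 2) =
    (fun n => \sum_i avg (fun j => x j i ord0 * x j i ord0) n).
  apply/funext => n; rewrite -avg_sum; congr (avg _ n).
  by apply/funext => j; rewrite sqr_enorm dotvE.
have -> : d%:R = \sum_i (1%:M : 'M[R]_d) i i.
  under eq_bigr do rewrite mxE eqxx.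
  by rewrite sumr_const card_ord.
by apply: cvg_sum_ord => i; exact: cov1.
Qed.

End residuals.

(** * Averages of waves over the residuals *)

Section waves.
Context (R : realType) (d : nat).
Implicit Types (t q x y : 'cV[R]_d) (tau : R -> R).

(** What the estimates below use of the sine and the cosine. *)
Definition trig1 tau : Prop :=
  (forall u, `|tau u| <= 1) /\ (forall u v, `|tau u - tau v| <= `|u - v|).

Lemma trig1_deriv tau tau' : (forall u, `|tau u| <= 1) ->
  (forall u : R, is_derive u 1 tau (tau' u)) -> (forall u, `|tau' u| <= 1) ->
  trig1 tau.
Proof.
move=> tau1 dtau tau'1; split => // u v.
wlog uv : u v / u <= v.
  move=> h; have [/h//|/ltW/h] := leP u v.
  by rewrite distrC (distrC u).
have [] := @MVT_segment R tau tau' u v uv (fun (x : R) _ => dtau x).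
  apply: continuous_subspaceT => z.
  by apply: differentiable_continuous; apply/derivable1_diffP; case: (dtau z).
move=> c _ h; rewrite distrC h normrM (distrC u).
by rewrite -[leRHS]mul1r ler_wpM2r.
Qed.

Lemma trig1_cos : trig1 (@cos R).
Proof.
apply: (@trig1_deriv _ (fun u => - sin u)) => u; rewrite ?normrN ler_norml.
  by rewrite cos_geN1 cos_le1.
by rewrite sin_geN1 sin_le1.
Qed.

Lemma trig1_sin : trig1 (@sin R).
Proof.
apply: (@trig1_deriv _ (@cos R)) => u; rewrite ler_norml.
  by rewrite sin_geN1 sin_le1.
by rewrite cos_geN1 cos_le1.
Qed.

(** Minus the Laplacian of t |-> tau(t.x), plus (|t|^2 - d) times this
    function, for tau a sine or cosine. *)
Definition wave tau t x : R :=
  (enorm x ^+ 2 + enorm t ^+ 2 - d%:R) * tau (dotv t x).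

(** The increments of [wave] are controlled by |x|^2 min(1, delta |x|): without
    the truncation at 1 the growth would be cubic, and the square would need a
    sixth moment. *)
Definition env k x : R :=
  (1 + enorm x ^+ 2) * Num.min 1 ((1 + enorm x) / k.+1%:R).

Lemma env_ge0 k x : 0 <= env k x.
Proof.
rewrite mulr_ge0 ?addr_ge0 ?sqr_ge0// le_min ler01/=.
by rewrite divr_ge0// addr_ge0 ?enorm_ge0.
Qed.

Lemma ler_norm_wave tau t x : trig1 tau ->
  `|wave tau t x| <= enorm x ^+ 2 + (enorm t ^+ 2 + d%:R).
Proof.
move=> [tau1 _]; rewrite /wave normrM -[leRHS]mulr1 ler_pM//.
rewrite ler_norml; have := sqr_ge0 (enorm x); have := sqr_ge0 (enorm t).
by have : 0 <= d%:R :> R by []; move=> *; apply/andP; split; lra.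
Qed.

Lemma ler_dist_trig1 tau u v b : trig1 tau -> `|u - v| <= b ->
  `|tau u - tau v| <= 2 * Num.min 1 b.
Proof.
move=> [tau1 tau2] uvb; case: (leP 1 b) => _.
  rewrite (le_trans (ler_normB _ _))//.
  by have := tau1 u; have := tau1 v; lra.
by have := tau2 u v; have := normr_ge0 (u - v); lra.
Qed.

Lemma ler_dist_sqr_enorm x y (r : R) : enorm (y - x) <= r ->
  `|enorm y ^+ 2 - enorm x ^+ 2| <= r * (r + 2 * enorm x).
Proof.
move=> yx; have h1 : enorm y <= enorm x + enorm (y - x).
  by rewrite -{1}(subrKC x y) ler_enormD.
have h2 : enorm x <= enorm y + enorm (y - x).
  by rewrite -(enormN (y - x)) opprB -{1}(subrKC y x) ler_enormD.
have x0 := enorm_ge0 x; have y0 := enorm_ge0 y.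
rewrite subr_sqr normrM; apply: ler_pM => //.
  by rewrite ler_norml; apply/andP; split; lra.
by rewrite ger0_norm ?addr_ge0//; lra.
Qed.

(** The phase t.y - q.x = t.(y - x) + (t - q).x is at most
    (1 + |x|)/(k + 1), and tau is 1-Lipschitz and bounded by 1. *)
Lemma ler_dist_wave tau t q x y (e : R) k : trig1 tau -> 0 <= e <= 1 ->
  enorm (y - x) <= e * (1 + enorm x) ->
  enorm t * e + enorm (t - q) <= k.+1%:R^-1 ->
  `|wave tau t y - wave tau q x| <=
    6 * e * (1 + enorm x ^+ 2) + `|enorm t ^+ 2 - enorm q ^+ 2| +
    2 * (enorm q ^+ 2 + d%:R + 1) * env k x.
Proof.
move=> htau /andP[e0 e1] yx tq.
have x0 := enorm_ge0 x.
have -> : wave tau t y - wave tau q x =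
    ((enorm y ^+ 2 - enorm x ^+ 2) + (enorm t ^+ 2 - enorm q ^+ 2)) * tau (dotv t y)
    + (enorm x ^+ 2 + enorm q ^+ 2 - d%:R) * (tau (dotv t y) - tau (dotv q x)).
  rewrite /wave; ring.
apply: (le_trans (ler_normD _ _)); apply: lerD.
  rewrite normrM -[leRHS]mulr1; apply: ler_pM => //; last by case: htau.
  apply: (le_trans (ler_normD _ _)); rewrite lerD2r.
  apply: (le_trans (ler_dist_sqr_enorm yx)).
  set r := enorm x in x0 *.
  have h : e * (1 + r) <= 1 + r by rewrite ger_pMl//; lra.
  apply: (@le_trans _ _ (e * (1 + r) * (3 * (1 + r)))).
    by rewrite ler_wpM2l ?mulr_ge0//; lra.
  rewrite -mulrA [leRHS](mulrAC 6) [leRHS]mulrC ler_wpM2l//.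
  have := sqr_ge0 (r - 1); lra.
rewrite normrM /env mulrA.
rewrite [leRHS](_ : _ = (enorm q ^+ 2 + d%:R + 1) * (1 + enorm x ^+ 2) *
  (2 * Num.min 1 ((1 + enorm x) / k.+1%:R))); last by ring.
apply: ler_pM => //.
  have q0 := sqr_ge0 (enorm q); have x2 := sqr_ge0 (enorm x).
  have d0 : 0 <= d%:R :> R by [].
  rewrite ler_norml; apply/andP; split; nra.
apply: ler_dist_trig1 => //.
have -> : dotv t y - dotv q x = dotv t (y - x) + dotv (t - q) x.
  by rewrite dotvBr dotvBl; ring.
apply: (le_trans (ler_normD _ _)).
apply: (le_trans (lerD (ler_dotv _ _) (ler_dotv _ _))).
apply: (@le_trans _ _ ((enorm t * e + enorm (t - q)) * (1 + enorm x))).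
  rewrite mulrDl lerD//.
    by rewrite -mulrA ler_wpM2l// enorm_ge0.
  by rewrite ler_wpM2l ?enorm_ge0//; lra.
by rewrite [leRHS]mulrC ler_wpM2r//; lra.
Qed.

Definition ratv (q : 'cV[rat]_d) : 'cV[R]_d := map_mx ratr q.

Lemma ratv_dense t (e : R) : 0 < e -> exists q : 'cV[rat]_d, enorm (t - ratv q) <= e.
Proof.
move=> e0; have d1 : 0 < d.+1%:R :> R by rewrite ltr0n.
have ed : 0 < e / d.+1%:R by rewrite divr_gt0.
have /choice[f hf] : forall i, exists r : rat,
    ratr r \in `]t i ord0, t i ord0 + e / d.+1%:R[.
  by move=> i; apply: rat_in_itvoo; rewrite ltrDl.
exists (\col_i f i); rewrite (le_trans (ler_enorm_sum _))//.
apply: (@le_trans _ _ (\sum_(i < d) e / d.+1%:R)).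
  apply: ler_sum => i _; rewrite !mxE.
  have := hf i; rewrite in_itv/= ler_norml => /andP[].
  move: ed; move: (e / _) (ratr (f i) : R) => s r s0 h1 h2.
  by apply/andP; split; lra.
rewrite sumr_const card_ord -[leLHS]mulr_natr mulrAC -mulrA ler_piMr ?(ltW e0)//.
by rewrite ler_pdivrMr// mul1r ler_nat.
Qed.

End waves.

Section wave_averages.
Context (R : realType) (d : nat) (x : nat -> 'cV[R]_d).
Context (H : nat -> R) (L : (R -> R) -> 'cV[R]_d -> R) (tau : R -> R).
Hypothesis mean0 : forall i, avg (fun j => x j i ord0) @ \oo --> (0 : R).
Hypothesis cov1 : forall i k, avg (fun j => x j i ord0 * x j k ord0) @ \oo -->
  ((1%:M : 'M[R]_d) i k).
Hypothesis avg_env : forall k, avg (fun j => env k (x j)) @ \oo --> H k.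
Hypothesis H0 : H @ \oo --> (0 : R).
Hypothesis tau1 : trig1 tau.
Hypothesis avg_wave : forall q : 'cV[rat]_d,
  avg (fun j => wave tau (ratv R q) (x j)) @ \oo --> L tau (ratv R q).
Hypothesis L_cont : forall t q k, enorm (t - q) <= k.+1%:R^-1 ->
  `|L tau t - L tau q| <= `|enorm t ^+ 2 - enorm q ^+ 2| +
    2 * (enorm q ^+ 2 + d%:R + 1) * H k.

(** Here x is one realization for which the laws of large numbers hold, with
    limits H k for the envelopes and L tau q for the waves at rational
    frequencies q.  The rate of the envelope is fixed first, then a rational q
    close to t, then how close the residuals must be. *)
Lemma cvg_avg_wave t :
  (fun n => avg (fun j => wave tau t (scaled_residual n x j)) n) @ \oo -->
    L tau t.
Proof.
(* at most seven errors of size e add up below *)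
apply/cvgrPdist_le => /= e0 e0_gt0; pose e := e0 / 8.
have e_gt0 : 0 < e by rewrite divr_gt0.
(* bounds the factor of the envelope for all q with |q|^2 <= |t|^2 + 1 *)
pose K := 2 * (enorm t ^+ 2 + 1 + d%:R + 1).
have K0 : 0 < K.
  have := sqr_ge0 (enorm t); have : 0 <= d%:R :> R by []; rewrite /K; lra.
have /cvgr0_norm_le/(_ (e / K)) [|k0 _ /(_ k0 (leqnn _)) Hk] := H0.
  by rewrite divr_gt0.
have {}Hk : K * H k0 <= e.
  by rewrite mulrC -ler_pdivlMr// (le_trans (ler_norm _)).
set k := k0 in Hk; have k1 : 0 < k.+1%:R^-1 :> R by rewrite invr_gt0 ltr0n.
have t0 := enorm_ge0 t.
have [q hq] : exists q, enorm (t - ratv R q) <= k.+1%:R^-1 / 2 /\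
    `|enorm t ^+ 2 - enorm (ratv R q) ^+ 2| <= Num.min e 1.
  pose r := Num.min (k.+1%:R^-1 / 2) (Num.min e 1 / (1 + 2 * enorm t)).
  have r1 : 0 < Num.min e 1 by rewrite lt_min e_gt0 ltr01.
  have tt : 0 < 1 + 2 * enorm t by lra.
  have r0 : 0 < Num.min 1 r.
    by rewrite !lt_min ltr01 !divr_gt0.
  have [q tq] := ratv_dense t r0; exists q.
  move: tq; rewrite !le_min => /and3P[tq1 tq2 tq3]; split => //.
  have := @ler_dist_sqr_enorm _ _ t (ratv R q) (enorm (t - ratv R q)).
  rewrite -enormN opprB distrC => /(_ (lexx _)) h.
  rewrite -le_min; apply: (le_trans h).
  move: tq3; rewrite ler_pdivlMr// => tq3; apply: le_trans tq3.
  by rewrite ler_wpM2l ?enorm_ge0// lerD2r.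
case: hq => tq; rewrite le_min => /andP[tq2 tq2'].
pose s := Num.min 1 (Num.min (k.+1%:R^-1 / 2 / (1 + enorm t)) (e / (6 * (d%:R + 2)))).
have dd : 0 <= d%:R :> R by [].
have s0 : 0 < s by rewrite !lt_min ltr01 !divr_gt0//; lra.
have [s1 s2 s3] : [/\ s <= 1, enorm t * s <= k.+1%:R^-1 / 2 & 6 * s * (d%:R + 2) <= e].
  have : s <= s by []; rewrite {2}/s !le_min => /and3P[h1 h2 h3]; split => //.
    rewrite ler_pdivlMr in h2; last lra.
    by apply: le_trans h2; rewrite mulrC ler_wpM2l ?(ltW s0)// lerDr.
  have d6 : 0 < 6 * (d%:R + 2) :> R by rewrite mulr_gt0// ltr_wpDl.
  by rewrite mulrAC mulrC -ler_pdivlMr.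
have tqk : enorm t * s + enorm (t - ratv R q) <= k.+1%:R^-1.
  by rewrite [leRHS]splitr lerD.
have Kq : 2 * (enorm (ratv R q) ^+ 2 + d%:R + 1) <= K.
  by move: tq2'; rewrite ler_norml /K => /andP[]; lra.
have hres := scaled_residual_close mean0 cov1 s0.
have /cvgrPdist_le/(_ 1 ltr01) hsq := cvg_avg_sqr_enorm cov1.
have /cvgrPdist_le/(_ (e / K)) hav := @avg_env k.
have {}hav := hav (divr_gt0 e_gt0 K0).
have /cvgrPdist_le/(_ e e_gt0) hwave   := @avg_wave q.
near=> n.
have n0 : (0 < n)%N by near: n; exact: nbhs_infty_gt.
have Hres j : enorm (scaled_residual n x j - x j) <= s * (1 + enorm (x j)).
  by move: j; near: n.
have Hsq : `|d%:R - avg (fun j => enorm (x j) ^+ 2) n| <= 1 by near: n.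
have Hav : `|H k - avg (fun j => env k (x j)) n| <= e / K by near: n.
have Hwave : `|L tau (ratv R q) - avg (fun j => wave tau (ratv R q) (x j)) n| <= e.
  by near: n.
have HL : `|L tau t - L tau (ratv R q)| <= e + K * H k.
  apply: (le_trans (L_cont (k := k) _)).
    by apply: le_trans tqk; rewrite lerDr mulr_ge0// ltW.
  rewrite lerD// ler_wpM2r//.
  rewrite -(cvg_lim _ (@avg_env k))//; apply: limr_ge; first exact: cvgP (@avg_env k).
  apply: nearW => p; rewrite divr_ge0// sumr_ge0// => j _; exact: env_ge0.
have step : `|avg (fun j => wave tau t (scaled_residual n x j)) n -
    avg (fun j => wave tau (ratv R q) (x j)) n| <=
    6 * s * (d%:R + 2) + e + K * (H k + e / K).
  rewrite -avgB; apply: (le_trans (ler_norm_avg _ _)).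
  apply: (@le_trans _ _ (avg (fun j => 6 * s * (1 + enorm (x j) ^+ 2) + e +
    K * env k (x j)) n)).
    apply: ler_avg => j.
    have s01 : 0 <= s <= 1 by rewrite s1 ltW.
    apply: (le_trans (ler_dist_wave tau1 s01 (Hres j) tqk)).
    by rewrite !lerD// ler_wpM2r// env_ge0.
  rewrite !(avgD, avgZ, avg_cst)// !lerD//.
    rewrite ler_wpM2l ?mulr_ge0 ?(ltW s0)//.
    by move: Hsq; rewrite ler_norml => /andP[]; lra.
  rewrite ler_wpM2l ?(ltW K0)//.
  by move: Hav; rewrite ler_norml => /andP[]; lra.
have KK : K * (H k + e / K) <= 2 * e.
  by rewrite mulrDr mulrC (mulrC K (e / K)) divfK ?gt_eqF// mulrC; lra.
have e8 : e0 = 8 * e by rewrite /e; field.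
move: step HL Hwave s3 KK Hk.
rewrite !ler_norml e8 => /andP[? ?] /andP[? ?] /andP[? ?] *.
by apply/andP; split; lra.
Unshelve. all: end_near. Qed.

End wave_averages.

(** * Convergence of the statistic along one realization *)

Section integrand.
Context (R : realType) (d : nat).
Implicit Types (x : nat -> 'cV[R]_d) (t : 'cV[R]_d).

Lemma empirical_cfE n x t : empirical_cf n x t =
  Complex (n%:R^-1 * \sum_(1 <= j < n.+1) cos (dotv t (scaled_residual n x j)))
          (n%:R^-1 * \sum_(1 <= j < n.+1) sin (dotv t (scaled_residual n x j))).
Proof.
rewrite /empirical_cf.
have -> : n%:R^-1 = (n%:R^-1)%:C%C :> R[i] by rewrite fmorphV/= rmorph_nat.
have sumE (r : seq nat) (u : nat -> R) : \sum_(j <- r) cis (u j) =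
    Complex (\sum_(j <- r) cos (u j)) (\sum_(j <- r) sin (u j)).
  by elim: r => [|j r ih]; rewrite ?big_nil// !big_cons ih.
by rewrite sumE; apply/eqP; rewrite eq_complex /= !mul0r subr0 addr0 !eqxx.
Qed.

Lemma integrandE n x t :
  ComplexField.Normc.normc
    (claplacian (empirical_cf n x) t
     - (enorm t ^+ 2 - d%:R)%:C%C * empirical_cf n x t) ^+ 2 =
  avg (fun j => wave (@cos R) t (scaled_residual n x j)) n ^+ 2 +
  avg (fun j => wave (@sin R) t (scaled_residual n x j)) n ^+ 2.
Proof.
rewrite /claplacian.
have -> : (fun s => complex.Re (empirical_cf n x s)) = (fun s => n%:R^-1 *
    \sum_(1 <= j < n.+1) cos (dotv s (scaled_residual n x j))).
  by apply/funext => s; rewrite empirical_cfE.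
have -> : (fun s => complex.Im (empirical_cf n x s)) = (fun s => n%:R^-1 *
    \sum_(1 <= j < n.+1) sin (dotv s (scaled_residual n x j))).
  by apply/funext => s; rewrite empirical_cfE.
rewrite (@laplacian_trig_sum _ _ (@cos R) (fun u => - sin u)).
rewrite (@laplacian_trig_sum _ _ (@sin R) (@cos R)).
rewrite empirical_cfE.
have E (tau : R -> R) : avg (fun j => wave tau t (scaled_residual n x j)) n =
    n%:R^-1 * \sum_(1 <= j < n.+1) enorm (scaled_residual n x j) ^+ 2 *
      tau (dotv t (scaled_residual n x j)) + (enorm t ^+ 2 - d%:R) *
    (n%:R^-1 * \sum_(1 <= j < n.+1) tau (dotv t (scaled_residual n x j))).
  rewrite mulrCA -mulrDr mulrC; congr (_ * _).
  rewrite mulr_sumr -big_split/=; apply: eq_bigr => j _.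
  by rewrite /wave -addrA mulrDl.
rewrite !E /= !mul0r subr0 addr0 -!opprD !sqrrN sqr_sqrtr//.
by rewrite addr_ge0 ?sqr_ge0.
Qed.

End integrand.

Section limit.
Context (R : realType) (d : nat) (x : nat -> 'cV[R]_d).
Context (H : nat -> R) (L : (R -> R) -> 'cV[R]_d -> R).
Hypothesis mean0 : forall i, avg (fun j => x j i ord0) @ \oo --> (0 : R).
Hypothesis cov1 : forall i k, avg (fun j => x j i ord0 * x j k ord0) @ \oo -->
  ((1%:M : 'M[R]_d) i k).
Hypothesis avg_env : forall k, avg (fun j => env k (x j)) @ \oo --> H k.
Hypothesis H0 : H @ \oo --> (0 : R).
Hypothesis avg_wave : forall tau (q : 'cV[rat]_d), tau = @cos R \/ tau = @sin R ->
  avg (fun j => wave tau (ratv R q) (x j)) @ \oo --> L tau (ratv R q).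
Hypothesis L_cont : forall tau t q k, tau = @cos R \/ tau = @sin R ->
  enorm (t - q) <= k.+1%:R^-1 ->
  `|L tau t - L tau q| <= `|enorm t ^+ 2 - enorm q ^+ 2| +
    2 * (enorm q ^+ 2 + d%:R + 1) * H k.

Let emp tau n t := avg (fun j => wave tau t (scaled_residual n x j)) n.

Let trig1_cos_or_sin tau : tau = @cos R \/ tau = @sin R -> trig1 tau.
Proof. by move=> [->|->]; [exact: trig1_cos|exact: trig1_sin]. Qed.

Let emp_cvg tau t : tau = @cos R \/ tau = @sin R ->
  emp tau ^~ t @ \oo --> L tau t.
Proof.
move=> ht; have ht1 := trig1_cos_or_sin ht.
apply: (cvg_avg_wave mean0 cov1 avg_env H0 ht1).
  by move=> q; exact: avg_wave.
by move=> s q k; exact: L_cont.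
Qed.

Let memp tau n : tau = @cos R \/ tau = @sin R -> measurable_fun setT (emp tau n).
Proof.
move=> ht; rewrite /emp /avg; apply: measurable_funM => //.
apply: measurable_sum => j; apply: measurable_funM.
  apply: measurable_funB => //; apply: measurable_funD => //.
  exact: measurable_sqr_enorm.
apply: measurableT_comp; last exact: measurable_dotv.
by case: ht => ->; apply: continuous_measurable_fun;
  [exact: continuous_cos|exact: continuous_sin].
Qed.

(** A single good realization gives measurability in t of the mean waves, as
    pointwise limits of finite sums. *)
Lemma measurable_limit tau : tau = @cos R \/ tau = @sin R ->
  measurable_fun setT (L tau).
Proof.
move=> ht; apply: (measurable_fun_cvg (h := emp tau)) => [n|t _].
  exact: memp.
exact: emp_cvg.
Qed.

(** Close residuals have |Y_j|^2 <= (1 + 2 |x_j|)^2 <= 2 + 8 |x_j|^2, and the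
    average of |x_j|^2 is at most d + 1 for large n: 10 + 9 d is
    2 + 8 (d + 1) + d. *)
Let K : R := 10 + 9 * d%:R.

Let emp_bound : \forall n \near \oo, forall tau t,
  tau = @cos R \/ tau = @sin R -> `|emp tau n t| <= K + enorm t ^+ 2.
Proof.
have hres := scaled_residual_close mean0 cov1 (@ltr01 R).
have /cvgrPdist_le/(_ 1 ltr01) hsq := cvg_avg_sqr_enorm cov1.
near=> n.
have n0 : (0 < n)%N by near: n; exact: nbhs_infty_gt.
have Hres j : enorm (scaled_residual n x j - x j) <= 1 * (1 + enorm (x j)).
  by move: j; near: n.
have Hsq : `|d%:R - avg (fun j => enorm (x j) ^+ 2) n| <= 1 by near: n.
move=> tau t ht; apply: (le_trans (ler_norm_avg _ _)).
apply: (@le_trans _ _ (avg (fun j => (2 + (enorm t ^+ 2 + d%:R)) +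
    8 * enorm (x j) ^+ 2) n)).
  apply: ler_avg => j.
  apply: (le_trans (ler_norm_wave _ _ (trig1_cos_or_sin ht))).
  rewrite addrAC lerD2r.
  set y := scaled_residual n x j.
  have : enorm y <= 1 + 2 * enorm (x j).
    rewrite -{1}(subrK (x j) y) (le_trans (ler_enormD _ _))//.
    have := Hres j; rewrite -/y; lra.
  have := enorm_ge0 y; have := enorm_ge0 (x j).
  move: (enorm y) (enorm (x j)) => b c b0 c0 bc.
  apply: (@le_trans _ _ ((1 + 2 * c) ^+ 2)).
    by rewrite ler_pXn2r// nnegrE; lra.
  have := sqr_ge0 (1 - 2 * c); lra.
rewrite avgD avgZ avg_cst// /K.
by move: Hsq; rewrite ler_norml => /andP[]; lra.
Unshelve. all: end_near. Qed.

Let F n (t : 'cV[R]_d) : R := (emp (@cos R) n t ^+ 2 + emp (@sin R) n t ^+ 2).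

Variables (a : R) (a0 : 0 < a).

Let G (t : 'cV[R]_d) : R := 2 * (K + 4 / a) ^+ 2 * gauss_weight (a / 2) t.

Let intG : (lebesgue_cV R d).-integrable setT (EFin \o G).
Proof.
have a2 : 0 < a / 2 by rewrite divr_gt0.
have G0 t : 0 <= G t by rewrite mulr_ge0 ?expR_ge0// mulr_ge0// sqr_ge0.
apply/integrableP; split.
  apply/measurable_EFinP; apply: measurable_funM => //.
  exact: measurable_gauss_weight.
under eq_integral do rewrite /= ger0_norm//.
under eq_integral do rewrite EFinM.
rewrite ge0_integralZl_EFin//.
- by rewrite lte_mul_pinfty// ?integral_gauss_weight_lt// lee_fin mulr_ge0 ?sqr_ge0.
- by move=> t _; rewrite lee_fin expR_ge0.
- by apply/measurable_EFinP; exact: measurable_gauss_weight.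
- by rewrite mulr_ge0 ?sqr_ge0.
Qed.

Let test_stat_div n : (0 < n)%N -> (test_stat a n x / n%:R%:E =
  \int[lebesgue_cV R d]_t (F n t * gauss_weight a t)%:E)%E.
Proof.
move=> n0; have n1 : n%:R != 0 :> R by rewrite pnatr_eq0 -lt0n.
rewrite /test_stat muleAC inver (negbTE n1) -EFinM divff// mul1e.
by apply: eq_integral => t _; rewrite integrandE.
Qed.

Lemma cvg_test_stat :
  (fun n => test_stat a n x / n%:R%:E)%E @ \oo -->
  (\int[lebesgue_cV R d]_t
    ((L (@cos R) t ^+ 2 + L (@sin R) t ^+ 2) * gauss_weight a t)%:E)%E.
Proof.
have [N _ HN] := emp_bound.
pose f n (t : 'cV[R]_d) : \bar R := (F (n + N.+1) t * gauss_weight a t)%:E.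
pose l (t : 'cV[R]_d) : \bar R := ((L (@cos R) t ^+ 2 + L (@sin R) t ^+ 2) * gauss_weight a t)%:E.
have mF n : measurable_fun setT (fun t => (F n t * gauss_weight a t)%:E).
  apply/measurable_EFinP; apply: measurable_funM; last exact: measurable_gauss_weight.
  by apply: measurable_funD; apply: measurable_funX; apply: memp; [left|right].
have mf n : measurable_fun setT (f n) by exact: mF.
have Flim t : F ^~ t @ \oo --> L (@cos R) t ^+ 2 + L (@sin R) t ^+ 2.
  by apply: cvgD; rewrite expr2; under eq_fun do rewrite expr2;
    apply: cvgM; apply: emp_cvg; by [left|right].
have fl t : f ^~ t @ \oo --> l t.
  apply: cvg_EFin; first exact: nearW.
  apply: cvgM; last exact: cvg_cst.
  have := Flim t; rewrite -(cvg_shiftn N.+1); exact.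
have ml : measurable_fun setT l.
  apply: (emeasurable_fun_cvg f) => // t _; exact: fl.
have fG n t : (`|f n t| <= (EFin \o G) t)%E.
  rewrite /f /= lee_fin normrM ger0_norm; last first.
    by rewrite addr_ge0 ?sqr_ge0.
  rewrite (ger0_norm (expR_ge0 _)).
  apply: (@le_trans _ _ (2 * ((K + enorm t ^+ 2) ^+ 2 * gauss_weight a t))).
    rewrite mulrA ler_wpM2r ?expR_ge0//.
    have Hb := HN (n + N.+1)%N (leq_trans (leqnSn N) (leq_addl _ _)).
    have sq (u v : R) : `|u| <= v -> u ^+ 2 <= v ^+ 2.
      move=> uv; rewrite -(real_normK (num_real u)) ler_pXn2r ?nnegrE//.
      exact: le_trans (normr_ge0 u) uv.
    have := sq _ _ (Hb (@cos R) t (or_introl erefl)).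
    have := sq _ _ (Hb (@sin R) t (or_intror erefl)).
    rewrite /F; lra.
  rewrite /G -mulrA ler_wpM2l// gauss_weight_growth// /K.
  by rewrite addr_ge0// mulr_ge0.
have [_ _] := @dominated_convergence _ _ _ (lebesgue_cV R d) setT measurableT f l
  (EFin \o G) mf ml (aeW _ (fun t _ => fl t)) intG (aeW _ (fun t n _ => fG n t)).
move=> h; rewrite -(cvg_shiftn N.+1).
apply: cvg_trans h; apply: near_eq_cvg; apply: nearW => n /=.
by rewrite test_stat_div// addnS.
Qed.

End limit.

(** * Moments of the waves and of their envelope *)

Lemma ae_forall_countable d (T : measurableType d) (R : realType)
    (mu : {measure set T -> \bar R}) (I : countType) (Q : I -> T -> Prop) :
  (forall i, {ae mu, forall w, Q i w}) -> {ae mu, forall w, forall i, Q i w}.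
Proof.
move=> h; pose Q' n w := if unpickle n is Some i then Q i w else True.
have : {ae mu, forall w, forall n, Q' n w}.
  apply: ae_foralln => n; rewrite /Q'; case: (unpickle n) => [i|] //.
  exact: aeW.
by apply: filterS => w hw i; have := hw (pickle i); rewrite /Q' pickleK.
Qed.

Section fourth_moment.
Context (R : realType) (d : nat) disp (T : measurableType disp).
Context (P : probability T R) (X : {RV P >-> 'cV[R]_d}).
Hypothesis m4 : (\int[P]_w (enorm (X w) ^+ 4)%:E < +oo)%E.

Let measX (f : 'cV[R]_d -> R) : measurable_fun setT f ->
  measurable_fun setT (fun w => f (X w)).
Proof. by move=> mf; exact: measurableT_comp. Qed.

Lemma integrable_affine (a b : R) (f : T -> R) :
  P.-integrable setT (EFin \o f) ->
  P.-integrable setT (EFin \o (fun w => a + b * f w)).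
Proof.
move=> intf.
rewrite (_ : EFin \o _ = (fun w => a%:E + b%:E * (f w)%:E)%E)//.
apply: integrableD => //; first exact: finite_measure_integrable_cst.
exact: integrableZl.
Qed.

Lemma square_moment_lt (f : 'cV[R]_d -> R) (A B : R) : measurable_fun setT f ->
  0 <= A -> 0 <= B -> (forall x, f x ^+ 2 <= A + B * enorm x ^+ 4) ->
  (\int[P]_w (f (X w) ^+ 2)%:E < +oo)%E.
Proof.
move=> mf A0 B0 fAB.
have m4X : measurable_fun setT (fun w => (enorm (X w) ^+ 4)%:E).
  apply/measurable_EFinP; apply: measurable_funX.
  by apply: measX; exact: measurable_enorm.
apply: (@le_lt_trans _ _ (\int[P]_w (A%:E + B%:E * (enorm (X w) ^+ 4)%:E))%E).
  apply: ge0_le_integral => //.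
  - by move=> w _; rewrite lee_fin sqr_ge0.
  - by apply/measurable_EFinP; apply: measurable_funX; exact: measX.
  - by apply: emeasurable_funD => //; exact: measurable_funeM.
  - by move=> w _; rewrite -EFinM -EFinD lee_fin.
have e4 w : (0 <= (enorm (X w) ^+ 4)%:E)%E.
  by rewrite lee_fin exprn_ge0// enorm_ge0.
rewrite ge0_integralD//=; last 2 first.
- by move=> w _; rewrite mule_ge0.
- exact: measurable_funeM.
rewrite integral_cst//= probability_setT mule1 ge0_integralZl_EFin//.
by rewrite lte_add_pinfty ?ltry// lte_mul_pinfty.
Qed.

Lemma measurable_env k : measurable_fun setT (@env R d k).
Proof.
apply: measurable_funM.
  by apply: measurable_funD => //; exact: measurable_sqr_enorm.
apply: measurable_minr => //; apply: measurable_funM => //.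
by apply: measurable_funD => //; exact: measurable_enorm.
Qed.

Lemma env_sqr_le k (x : 'cV[R]_d) : env k x ^+ 2 <= 2 + 2 * enorm x ^+ 4.
Proof.
have e1 : env k x <= 1 + enorm x ^+ 2.
  by rewrite /env -[leRHS]mulr1 ler_wpM2l ?addr_ge0 ?sqr_ge0// ge_min lexx.
apply: (@le_trans _ _ ((1 + enorm x ^+ 2) ^+ 2)).
  by rewrite ler_pXn2r ?nnegrE ?env_ge0 ?addr_ge0 ?sqr_ge0.
rewrite (exprM _ 2 2); have := sqr_ge0 (enorm x ^+ 2 - 1); lra.
Qed.

Lemma env_square_lt k : (\int[P]_w (env k (X w) ^+ 2)%:E < +oo)%E.
Proof.
by apply: (square_moment_lt (measurable_env k) _ _ (env_sqr_le k)).
Qed.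

Lemma integrable_env k : P.-integrable setT (EFin \o (fun w => env k (X w))).
Proof.
apply: square_integrable; last exact: env_square_lt.
by apply: measX; exact: measurable_env.
Qed.

(** env k x <= (1 + |x|^2)(1 + |x|)/(k + 1), and the numerator is at most
    4 + 4 |x|^4. *)
Lemma cvg_mean_env : (fun k => \int[P]_w env k (X w)) @ \oo --> (0 : R).
Proof.
pose q (x : 'cV[R]_d) := enorm x ^+ 4.
have mq : measurable_fun setT (fun w => q (X w)).
  by apply: measX; apply: measurable_funX; exact: measurable_enorm.
have q0 w : 0 <= q (X w) by rewrite exprn_ge0// enorm_ge0.
have iq : P.-integrable setT (EFin \o (fun w => q (X w))).
  apply/integrableP; split; first exact/measurable_EFinP.
  by under eq_integral do rewrite /= ger0_norm//.
have bnd k x : env k x <= (4 + 4 * q x) * k.+1%:R^-1.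
  have r0 := enorm_ge0 x; have k1 : 0 < k.+1%:R^-1 :> R by rewrite invr_gt0.
  apply: (@le_trans _ _ ((1 + enorm x ^+ 2) * ((1 + enorm x) / k.+1%:R))).
    by rewrite ler_wpM2l ?addr_ge0 ?sqr_ge0// ge_min lexx orbT.
  rewrite mulrA ler_wpM2r ?(ltW k1)// /q.
  rewrite (exprM _ 2 2).
  move: (enorm x) r0 => r r0.
  have h1 : 1 + r <= 2 * (1 + r ^+ 2) by have := sqr_ge0 (r - 1); have := sqr_ge0 r; lra.
  apply: (@le_trans _ _ ((1 + r ^+ 2) * (2 * (1 + r ^+ 2)))).
    by rewrite ler_wpM2l// addr_ge0// sqr_ge0.
  have := sqr_ge0 (r ^+ 2 - 1); lra.
have iB : P.-integrable setT (EFin \o (fun w => 4 + 4 * q (X w))).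
  exact: integrable_affine.
apply: (squeeze_cvgr (f := cst 0)
  (h := fun k => (\int[P]_w (4 + 4 * q (X w))) * k.+1%:R^-1)).
- apply: nearW => k; apply/andP; split.
    by apply: Rintegral_ge0 => w _; exact: env_ge0.
  rewrite -RintegralZr//; apply: le_Rintegral => //; first exact: integrable_env.
  under [X in _.-integrable _ (EFin \o X)]eq_fun do rewrite mulrDl mulrAC.
  exact: integrable_affine.
- exact: cvg_cst.
- rewrite -[X in _ --> X](mulr0 (\int[P]_w (4 + 4 * q (X w)))).
  apply: cvgM; first exact: cvg_cst.
  exact: cvg_harmonic.
Qed.

Section wave_moments.
Variable tau : R -> R.
Hypotheses (tau1 : trig1 tau) (mtau : measurable_fun setT tau).

Lemma measurable_wave t : measurable_fun setT (@wave R d tau t).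
Proof.
apply: measurable_funM.
  apply: measurable_funB => //; apply: measurable_funD => //.
  exact: measurable_sqr_enorm.
by apply: measurableT_comp => //; exact: measurable_dotvr.
Qed.

Lemma wave_square_lt t : (\int[P]_w (wave tau t (X w) ^+ 2)%:E < +oo)%E.
Proof.
pose c := enorm t ^+ 2 + d%:R.
have c0 : 0 <= c by rewrite addr_ge0// sqr_ge0.
apply: (@square_moment_lt _ (2 * c ^+ 2) 2 (measurable_wave t)) => //.
  by rewrite mulr_ge0// sqr_ge0.
move=> x; rewrite (exprM _ 2 2).
have h : `|wave tau t x| <= enorm x ^+ 2 + c by exact: ler_norm_wave.
rewrite -(real_normK (num_real (wave tau t x))).
apply: (@le_trans _ _ ((enorm x ^+ 2 + c) ^+ 2)).
  by rewrite ler_pXn2r ?nnegrE ?addr_ge0 ?sqr_ge0.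
have := sqr_ge0 (enorm x ^+ 2 - c); lra.
Qed.

Lemma integrable_wave t : P.-integrable setT (EFin \o (fun w => wave tau t (X w))).
Proof.
apply: square_integrable; last exact: wave_square_lt.
by apply: measX; exact: measurable_wave.
Qed.

Lemma mean_wave_modulus t q k : enorm (t - q) <= k.+1%:R^-1 ->
  `|\int[P]_w wave tau t (X w) - \int[P]_w wave tau q (X w)| <=
    `|enorm t ^+ 2 - enorm q ^+ 2| +
    2 * (enorm q ^+ 2 + d%:R + 1) * \int[P]_w env k (X w).
Proof.
move=> tq; set b := 2 * (enorm q ^+ 2 + d%:R + 1).
rewrite -RintegralB//; [|exact: integrable_wave|exact: integrable_wave].
have iD : P.-integrable setT
    (EFin \o (fun w => wave tau t (X w) - wave tau q (X w))).
  rewrite (_ : _ \o _ = (EFin \o (fun w => wave tau t (X w))) \-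
    (EFin \o (fun w => wave tau q (X w))))%E//.
  by apply: integrableB => //; exact: integrable_wave.
apply: (le_trans (le_normr_Rintegral measurableT iD)).
have ic : P.-integrable setT (EFin \o (fun=> `|enorm t ^+ 2 - enorm q ^+ 2|)).
  exact: finite_measure_integrable_cst.
have ib : P.-integrable setT (EFin \o (fun w => b * env k (X w))).
  under [X in _.-integrable _ (EFin \o X)]eq_fun do rewrite -[_ * _]add0r.
  by apply: integrable_affine; exact: integrable_env.
have -> : `|enorm t ^+ 2 - enorm q ^+ 2| + b * \int[P]_w env k (X w) =
    \int[P]_w (`|enorm t ^+ 2 - enorm q ^+ 2| + b * env k (X w)).
  rewrite RintegralD// Rintegral_cst// RintegralZl//; last exact: integrable_env.
  rewrite -[X in X + _ = _]mulr1; congr (_ * _ + _).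
  exact: (congr1 fine (esym (probability_setT P))).
apply: le_Rintegral => //.
- exact: integrable_norm iD.
- by apply: integrable_affine; exact: integrable_env.
move=> w _; have := @ler_dist_wave R d tau t q (X w) (X w) 0 k tau1.
rewrite lexx ler01 subrr enorm0 !mul0r mulr0 add0r mulr0 mul0r add0r.
by apply.
Qed.

End wave_moments.
End fourth_moment.

(** * The limit function, and the theorem *)

Lemma adde_self_inj (R : realFieldType) (x y : \bar R) :
  (0 <= x)%E -> (0 <= y)%E -> (x + x = y + y)%E -> x = y.
Proof.
case: x => [u| |]; case: y => [v| |] //= _ _ [uv].
by congr (_%:E); lra.
Qed.

Section limit_function.
Context (R : realType) (d : nat) disp (T : measurableType disp).
Context (P : probability T R) (X : {RV P >-> 'cV[R]_d}).
Hypothesis m4 : (\int[P]_w (enorm (X w) ^+ 4)%:E < +oo)%E.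

Definition mean_wave (tau : R -> R) (t : 'cV[R]_d) : R :=
  \int[P]_w wave tau t (X w).

Let cosL := mean_wave (@cos R).
Let sinL := mean_wave (@sin R).

Let mcos : measurable_fun setT (@cos R).
Proof. exact: continuous_measurable_fun (@continuous_cos R). Qed.

Let msin : measurable_fun setT (@sin R).
Proof. exact: continuous_measurable_fun (@continuous_sin R). Qed.

Let icos t := @integrable_wave _ _ _ _ _ _ m4 _ (@trig1_cos R) mcos t.
Let isin t := @integrable_wave _ _ _ _ _ _ m4 _ (@trig1_sin R) msin t.

Lemma mean_wave_cosN t : cosL (- t) = cosL t.
Proof.
by apply: eq_Rintegral => w _; rewrite /wave enormN dotvNl cosN.
Qed.

Lemma mean_wave_sinN t : sinL (- t) = - sinL t.
Proof.
rewrite /sinL /mean_wave -mulN1r -RintegralZl//.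
apply: eq_Rintegral => w _; rewrite /wave enormN dotvNl sinN; ring.
Qed.

Lemma entry_mul_square_lt i k :
  (\int[P]_w ((X w i ord0 * X w k ord0) ^+ 2)%:E < +oo)%E.
Proof.
apply: (@square_moment_lt _ _ _ _ _ X m4 (fun x => x i ord0 * x k ord0) 0 1) => //.
  by apply: measurable_funM; exact: measurable_entry.
move=> x; rewrite add0r mul1r (exprM _ 2 2) exprMn.
rewrite -(real_normK (num_real (x i ord0))) -(real_normK (num_real (x k ord0))).
rewrite [leRHS]expr2; apply: ler_pM; rewrite ?sqr_ge0//.
  by rewrite ler_pXn2r ?nnegrE ?enorm_ge0// ler_entry_enorm.
by rewrite ler_pXn2r ?nnegrE ?enorm_ge0// ler_entry_enorm.
Qed.

Lemma entry_square_lt i : (\int[P]_w (X w i ord0 ^+ 2)%:E < +oo)%E.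
Proof.
apply: (@square_moment_lt _ _ _ _ _ _ m4 (fun x => x i ord0) 1 1) => //.
  exact: measurable_entry.
move=> x; rewrite mul1r (exprM _ 2 2).
apply: (@le_trans _ _ (enorm x ^+ 2)).
  rewrite -(real_normK (num_real (x i ord0))) ler_pXn2r ?nnegrE ?enorm_ge0//.
  exact: ler_entry_enorm.
have := sqr_ge0 (enorm x ^+ 2 - 1); have := sqr_ge0 (enorm x ^+ 2); lra.
Qed.

Let integrable_entry_sqr i :
  P.-integrable setT (EFin \o (fun w => X w i ord0 * X w i ord0)).
Proof.
apply: square_integrable; last exact: entry_mul_square_lt.
by apply: measurable_funM; exact: measurable_entry_RV.
Qed.

Let integrable_entry i : P.-integrable setT (EFin \o (fun w => X w i ord0)).
Proof.
apply: square_integrable; last exact: entry_square_lt.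
exact: measurable_entry_RV.
Qed.

Let integrable_sqr_enorm : P.-integrable setT (EFin \o (fun w => enorm (X w) ^+ 2)).
Proof.
have mX2 : measurable_fun setT (fun w => enorm (X w) ^+ 2).
  exact: (measurableT_comp (@measurable_sqr_enorm R d)).
apply: square_integrable => //.
by under eq_integral do rewrite -exprM.
Qed.

(** Hartley's kernel cos + sin solves tau'' = - tau like its two summands, so
    psi^+ is differentiated as a single trigonometric mean. *)
Lemma zfunE t : zfun X t = cosL t + sinL t.
Proof.
pose cas (u : R) := cos u + sin u; pose cas' (u : R) := - sin u + cos u.
have d1 (u : R) : is_derive u 1 cas (cas' u) by exact: is_deriveD.
have d2 (u : R) : is_derive u 1 cas' (- cas u).
  by rewrite /cas opprD; exact: is_deriveD.
have b1 u : `|cas u| <= 2.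
  have := cos_le1 u; have := cos_geN1 u; have := sin_le1 u; have := sin_geN1 u.
  by rewrite ler_norml /cas => *; apply/andP; split; lra.
have b2 u : `|cas' u| <= 2.
  have := cos_le1 u; have := cos_geN1 u; have := sin_le1 u; have := sin_geN1 u.
  by rewrite ler_norml /cas' => *; apply/andP; split; lra.
have i1 : P.-integrable setT (EFin \o (cst 1 : T -> R)).
  exact: finite_measure_integrable_cst.
have mtrig (tau : R -> R) s : measurable_fun setT tau ->
    measurable_fun setT (fun w => tau (dotv s (X w))).
  move=> mtau; apply: measurableT_comp => //.
  exact: (measurableT_comp (measurable_dotvr s)).
have itrig (tau : R -> R) s : measurable_fun setT tau -> (forall u, `|tau u| <= 2) ->
    P.-integrable setT (EFin \o (fun w => tau (dotv s (X w)))).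
  move=> mtau tau2.
  have := integrable_bounded_factor i1 (mtrig tau s mtau) (fun w => tau2 _).
  rewrite (_ : (fun w => _ * _) = (fun w => tau (dotv s (X w))))//.
  by apply/funext => w; rewrite mul1r.
have cos2 u : `|cos u| <= 2 :> R.
  by rewrite (le_trans ((trig1_cos R).1 u))// ler1n.
have sin2 u : `|sin u| <= 2 :> R.
  by rewrite (le_trans ((trig1_sin R).1 u))// ler1n.
have mcas : measurable_fun setT cas by exact: measurable_funD.
have psiE : psi_plus X = fun s => \int[P]_w cas (dotv s (X w)).
  apply/funext => s; rewrite /psi_plus unlock.
  by rewrite -[LHS]RintegralD//; exact: itrig.
rewrite /zfun psiE (laplacian_expectation t d1 d2 b1 b2)// opprK.
rewrite /cosL /sinL /mean_wave -RintegralD//.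
rewrite -RintegralZl//; last exact: itrig.
rewrite -RintegralD//.
- by apply: eq_Rintegral => w _; rewrite /wave /cas; ring.
- by apply: (integrable_bounded_factor integrable_sqr_enorm (mtrig cas t mcas) (fun w => b1 _)).
- under [X in _.-integrable _ (EFin \o X)]eq_fun do rewrite -[_ * _]add0r.
  by apply: integrable_affine; exact: itrig.
Qed.

(** The cosine part is even and the sine part odd in t, so the cross term of
    the square integrates to zero against the even weight. *)
Lemma GammaE a : measurable_fun setT cosL -> measurable_fun setT sinL ->
  Gamma X a = (\int[lebesgue_cV R d]_t
    ((cosL t ^+ 2 + sinL t ^+ 2) * gauss_weight a t)%:E)%E.
Proof.
move=> mC mS; rewrite /Gamma.
pose g t := ((zfun X t ^+ 2 * gauss_weight a t)%:E)%E.
pose h t := (((cosL t ^+ 2 + sinL t ^+ 2) * gauss_weight a t)%:E)%E.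
have mw := @measurable_gauss_weight R d a.
have mz : measurable_fun setT (zfun X).
  rewrite (_ : zfun X = (fun t => cosL t + sinL t)); first exact: measurable_funD.
  by apply/funext => t; exact: zfunE.
have mg : measurable_fun setT g.
  by apply/measurable_EFinP; apply: measurable_funM => //; exact: measurable_funX.
have mh : measurable_fun setT h.
  apply/measurable_EFinP; apply: measurable_funM => //.
  by apply: measurable_funD; exact: measurable_funX.
have g0 t : (0 <= g t)%E by rewrite lee_fin mulr_ge0 ?sqr_ge0 ?expR_ge0.
have h0 t : (0 <= h t)%E.
  by rewrite lee_fin mulr_ge0 ?expR_ge0// addr_ge0 ?sqr_ge0.
have gN := ge0_integral_lebesgue_cVN mg g0.
(* z(t)^2 + z(-t)^2 = 2 (C(t)^2 + S(t)^2), and both terms on the left have the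
   same integral *)
have : (\int[lebesgue_cV R d]_t g t + \int[lebesgue_cV R d]_t g (- t)%R =
  \int[lebesgue_cV R d]_t h t + \int[lebesgue_cV R d]_t h t)%E.
  have mgN : measurable_fun setT (fun t : 'cV[R]_d => g (- t)).
    exact: (measurableT_comp mg (@measurable_oppv R d)).
  rewrite -(ge0_integralD _ measurableT (fun t _ => g0 t) mg
    (fun (t : 'cV[R]_d) _ => g0 (- t)) mgN).
  rewrite -(ge0_integralD _ measurableT (fun t _ => h0 t) mh
    (fun t _ => h0 t) mh).
  apply: eq_integral => t _; rewrite -!EFinD !zfunE mean_wave_cosN mean_wave_sinN.
  by rewrite /gauss_weight enormN; congr (_%:E); ring.
rewrite gN; apply: adde_self_inj; first exact: integral_ge0.
exact: integral_ge0.
Qed.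

End limit_function.

Theorem theorem4p1 (R : realType) (disp : measure_display)
    (Omega : measurableType disp) (P : probability Omega R)
    (d : nat) (a : R) (X : nat -> {RV P >-> 'cV[R]_d})
    (hd : (0 < d)%N) (ha : 0 < a)
    (hindep : mutually_independent X) (hident : identically_distributed X)
    (hac : distribution P (X 0%N) `<< lebesgue_cV R d)
    (hmom : ('E_P[fun w => (enorm (X 0%N w) ^+ 4)%R] < +oo)%E)
    (hmean : forall i : 'I_d, ('E_P[fun w => X 0%N w i ord0] = 0)%E)
    (hcov : forall i j : 'I_d,
      ('E_P[fun w => (X 0%N w *m (X 0%N w)^T)%R i j]
       = ((1%:M : 'M[R]_d) i j)%:E)%E) :
  {ae P, forall w : Omega,
    (fun n : nat => (test_stat a n (fun j => X j w) / n%:R%:E)%E) @ \oo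
      --> Gamma (X 0%N) a}.
Proof.
have m4 : (\int[P]_w (enorm (X 0%N w) ^+ 4)%:E < +oo)%E.
  by move: hmom; rewrite unlock.
have mcos : measurable_fun setT (@cos R).
  exact: continuous_measurable_fun (@continuous_cos R).
have msin : measurable_fun setT (@sin R).
  exact: continuous_measurable_fun (@continuous_sin R).
have law (f : 'cV[R]_d -> R) : measurable_fun setT f ->
    (\int[P]_w (f (X 0%N w) ^+ 2)%:E < +oo)%E ->
    {ae P, forall w, avg (fun j => f (X j w)) @ \oo --> \int[P]_w f (X 0%N w)}.
  by move=> mf f2; exact: (strong_law_iid hindep hident mf f2).
have ae_mean : {ae P, forall w, forall i,
    avg (fun j => X j w i ord0) @ \oo --> (0 : R)}.
  apply: ae_forall_countable => i.
  have <- : \int[P]_w X 0%N w i ord0 = 0 :> R.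
    by have := hmean i; rewrite unlock /Rintegral => ->.
  apply: (law (fun x => x i ord0)); first exact: measurable_entry.
  exact: entry_square_lt.
have ae_cov : {ae P, forall w, forall ik : 'I_d * 'I_d,
    avg (fun j => X j w ik.1 ord0 * X j w ik.2 ord0) @ \oo -->
      (1%:M : 'M[R]_d) ik.1 ik.2}.
  apply: ae_forall_countable => -[i k] /=.
  have <- : \int[P]_w (X 0%N w i ord0 * X 0%N w k ord0) = (1%:M : 'M[R]_d) i k.
    have := hcov i k.
    rewrite (_ : (fun w => _) = (fun w => X 0%N w i ord0 * X 0%N w k ord0)).
      by rewrite unlock /Rintegral => ->.
    by apply/funext => w; rewrite mxE big_ord1 mxE.
  apply: (law (fun x => x i ord0 * x k ord0)).
    by apply: measurable_funM; exact: measurable_entry.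
  exact: entry_mul_square_lt.
have ae_env : {ae P, forall w, forall k,
    avg (fun j => env k (X j w)) @ \oo --> \int[P]_w env k (X 0%N w)}.
  apply: ae_forall_countable => k; apply: law; first exact: measurable_env.
  exact: env_square_lt.
have ae_wave tau : trig1 tau -> measurable_fun setT tau ->
    {ae P, forall w, forall q : 'cV[rat]_d,
    avg (fun j => wave tau (ratv R q) (X j w)) @ \oo -->
      mean_wave (X 0%N) tau (ratv R q)}.
  move=> tau1 mtau; apply: ae_forall_countable => q.
  apply: law; first exact: measurable_wave.
  exact: wave_square_lt.
have ae_cos := ae_wave _ (trig1_cos R) mcos.
have ae_sin := ae_wave _ (trig1_sin R) msin.
have ae_data : {ae P, forall w, [/\ (forall i,
      avg (fun j => X j w i ord0) @ \oo --> (0 : R)),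
    (forall ik : 'I_d * 'I_d,
      avg (fun j => X j w ik.1 ord0 * X j w ik.2 ord0) @ \oo -->
        (1%:M : 'M[R]_d) ik.1 ik.2) &
    (forall k, avg (fun j => env k (X j w)) @ \oo --> \int[P]_w env k (X 0%N w))]}.
  by move: ae_mean ae_cov ae_env; apply: filterS3 => w.
move: ae_data ae_cos ae_sin; apply: filterS3 => w [hm hc he] hcos hsin.
have hc' i k : avg (fun j => X j w i ord0 * X j w k ord0) @ \oo -->
    (1%:M : 'M[R]_d) i k by exact: (hc (i, k)).
have hwave tau (q : 'cV[rat]_d) : tau = @cos R \/ tau = @sin R ->
    avg (fun j => wave tau (ratv R q) (X j w)) @ \oo -->
      mean_wave (X 0%N) tau (ratv R q) by case=> ->.
have hmod tau t q k : tau = @cos R \/ tau = @sin R ->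
    enorm (t - q) <= k.+1%:R^-1 ->
    `|mean_wave (X 0%N) tau t - mean_wave (X 0%N) tau q| <=
      `|enorm t ^+ 2 - enorm q ^+ 2| +
      2 * (enorm q ^+ 2 + d%:R + 1) * \int[P]_w env k (X 0%N w).
  case=> ->; [exact: (mean_wave_modulus m4 (trig1_cos R) mcos)|].
  exact: (mean_wave_modulus m4 (trig1_sin R) msin).
have H0 := cvg_mean_env m4.
have mL tau : tau = @cos R \/ tau = @sin R ->
    measurable_fun setT (mean_wave (X 0%N) tau).
  exact: (measurable_limit hm hc' he H0 hwave hmod).
rewrite (GammaE m4); [|by apply: mL; left|by apply: mL; right].
exact: (cvg_test_stat hm hc' he H0 hwave hmod ha).
Qed.
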